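(* Let $\mu\in V_n$ be an arbitrary algebra on $\mathbb C^n$. Then (1) $\mu$ admits a Nikolayevsky derivation $\phi_\mu$; (2) $\phi_\mu$ is unique up to automorphisms of $\mu$ (i.e. any two Nikolayevsky derivations are conjugate by an automorphism of $\mu$); (3) all eigenvalues of $\phi_\mu$ are rational numbers. Moreover, if $[\mu]$ is a critical point of $F_n:\mathbb PV_n\to\mathbb R$ with $\mathrm M_\mu=c_\mu I+D_\mu$, $c_\mu\in\mathbb R$, $D_\mu\in\mathrm{Der}(\mu)$, then $-\frac1{c_\mu}D_\mu$ is a Nikolayevsky derivation of $\mu$.
   Context: $V_n$ is the space of bilinear maps $\mu:\mathbb C^n\times\mathbb C^n\to\mathbb C^n$ (arbitrary complex algebras). $\mathrm{Der}(\mu)$ is its derivation algebra. A Nikolayevsky derivation of $\mu$ is a derivation $\phi\in\mathrm{Der}(\mu)$ which is semisimple (diagonalizable) with all eigenvalues real and satisfies $\operatorname{tr}(\phi\psi)=\operatorname{tr}\psi$ for all $\psi\in\mathrm{Der}(\mu)$. With the standard Hermitian inner product on $\mathbb C^n$, $L^\mu_XY=\mu(X,Y)$, $R^\mu_XY=\mu(Y,X)$, $\mathrm M_\mu=2\sum_i L^\mu_{X_i}(L^\mu_{X_i})^*-2\sum_i (L^\mu_{X_i})^*L^\mu_{X_i}-2\sum_i (R^\mu_{X_i})^*R^\mu_{X_i}$ for an orthonormal basis $\{X_i\}$, and $F_n([\mu])=\operatorname{tr}\mathrm M_\mu^2/\|\mu\|^4$ with $\|\mu\|^2=\sum_{i,j}\|\mu(X_i,X_j)\|^2$.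 $[\mu]$ is a critical point of $F_n$ iff $\mathrm M_\mu=c_\mu I+D_\mu$ with $c_\mu\in\mathbb R$, $D_\mu\in\mathrm{Der}(\mu)$. *)

(* Defs.v *)
From HB Require Import structures.
From mathcomp Require Import all_boot all_order all_algebra.
From mathcomp Require Import complex.
From mathcomp Require Import reals.
Set Implicit Arguments. Unset Strict Implicit. Unset Printing Implicit Defensive.
Import Order.TTheory GRing.Theory Num.Theory.
Local Open Scope ring_scope.

(* Vectors of C^n are column vectors 'cV[R[i]]_n; the standard basis is
   delta_mx i 0; the standard Hermitian inner product is <X,Y> = Y^* X. *)

(* An element mu of V_n (a bilinear map C^n x C^n -> C^n) is given by its
   values on pairs of standard basis vectors: mu i j = mu(e_i, e_j). *)
Definition alg (R : realType) (n : nat) := 'I_n -> 'I_n -> 'cV[R[i]]_n.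

Definition amul (R : realType) (n : nat) (mu : alg R n) (X Y : 'cV[R[i]]_n)
  : 'cV[R[i]]_n :=
  \sum_(i < n) \sum_(j < n) (X i 0 * Y j 0) *: mu i j.

Definition is_der (R : realType) (n : nat) (mu : alg R n) (D : 'M[R[i]]_n) :=
  forall X Y : 'cV[R[i]]_n,
    D *m amul mu X Y = amul mu (D *m X) Y + amul mu X (D *m Y).

Definition is_aut (R : realType) (n : nat) (mu : alg R n) (g : 'M[R[i]]_n) :=
  g \in unitmx /\
  forall X Y : 'cV[R[i]]_n, g *m amul mu X Y = amul mu (g *m X) (g *m Y).

Definition real_semisimple (R : realType) (n : nat) (phi : 'M[R[i]]_n) :=
  exists (P : 'M[R[i]]_n) (d : 'rV[R[i]]_n),
    [/\ P \in unitmx, (forall k, d 0 k \is Num.real) &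
        phi = P *m diag_mx d *m invmx P].

Definition is_nik (R : realType) (n : nat) (mu : alg R n) (phi : 'M[R[i]]_n) :=
  [/\ is_der mu phi, real_semisimple phi &
      forall psi, is_der mu psi -> \tr (phi *m psi) = \tr psi].

Definition adj (R : realType) (n : nat) (A : 'M[R[i]]_n) : 'M[R[i]]_n :=
  (map_mx Num.conj A)^T.

Definition Lmx (R : realType) (n : nat) (mu : alg R n) (i : 'I_n) : 'M[R[i]]_n :=
  \matrix_(k, j) mu i j k 0.
Definition Rmx (R : realType) (n : nat) (mu : alg R n) (i : 'I_n) : 'M[R[i]]_n :=
  \matrix_(k, j) mu j i k 0.

Definition Mmu (R : realType) (n : nat) (mu : alg R n) : 'M[R[i]]_n :=
  2%:R *: (\sum_(i < n) Lmx mu i *m adj (Lmx mu i))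
  - 2%:R *: (\sum_(i < n) adj (Lmx mu i) *m Lmx mu i)
  - 2%:R *: (\sum_(i < n) adj (Rmx mu i) *m Rmx mu i).

(* [mu] is a critical point of F_n with M_mu = c I + D, D in Der(mu)
   (the characterization given in the paper); mu <> 0 since [mu] lies in P V_n. *)
Definition crit_data (R : realType) (n : nat) (mu : alg R n) (c : R)
  (D : 'M[R[i]]_n) :=
  [/\ mu <> (fun _ _ => 0), is_der mu D & Mmu mu = (c%:C)%C%:M + D].

(* Main.v *)
Require Import Defs.
From HB Require Import structures.
From mathcomp Require Import all_boot all_order all_algebra.
From mathcomp Require Import complex.
From mathcomp Require Import reals.
From mathcomp Require Import boolp separable ring zify.
Import Order.TTheory GRing.Theory Num.Theory.
Local Open Scope ring_scope.
Set Implicit Arguments. Unset Strict Implicit. Unset Printing Implicit Defensive.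

(** In a basis [P], [diag d] is a derivation iff d_k = d_i + d_j whenever the
    structure constant mu_ij^k is nonzero.  This is a rational linear condition,
    so the orthogonal projection of (1,...,1) onto the space of such [d] is
    rational; a diagonal Nikolayevsky derivation must be that projection.

    Existence: only finitely many supports {(i,j,k) | mu_ij^k != 0} occur as the
    basis varies; take one whose projection has maximal norm, and let phi be the
    corresponding derivation.  To check tr(phi psi) = tr psi, project psi to the
    centraliser of phi, replace it by its semisimple part (again a derivation),
    diagonalise it together with phi, and compare phi with the projection in the
    new basis.

    Uniqueness: the difference of two Nikolayevsky derivations lies in the
    radical of the trace form on Der(mu), an ideal of nilpotent derivations, hence
    by Engel strictly triangular for a flag.  Along the filtration of matrices
    induced by the flag the first derivation is moved to the second one by
    successive automorphisms exp(x), x in the radical; the part of the difference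
    that commutes with the first derivation is not removed by exp(x) but vanishes
    because both derivations are semisimple.

    Critical points: tr(M_mu psi) = 0 for every derivation psi, since this trace
    is twice the inner product of psi.mu with mu. *)

(** * Semisimple and nilpotent matrices *)

(** Chinese remainder theorem: a Bezout multiple of the product over the earlier roots, congruent to
    1 modulo the new factor, corrects [p'] there. Exponent 1 is interpolation; exponent n+1 serves
    the Jordan decomposition. *)
Lemma poly_crt (F : fieldType) (rs : seq F) (f : F -> F) m :
  exists p : {poly F}, {in rs, forall a, ('X - a%:P) ^+ m %| p - (f a)%:P}.
Proof.
elim: rs => [|a rs [p' Hp']]; first by exists 0.
have [a_rs|a_rs] := boolP (a \in rs).
  by exists p' => b; rewrite inE => /predU1P[->|]; exact: Hp'.
pose q := \prod_(b <- rs) ('X - b%:P) ^+ m.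
have co_q : coprimep ('X - a%:P) q.
  rewrite /q big_seq; apply: (big_ind (fun q => coprimep _ q)) => [|u v|b b_rs].
  - exact: coprimep1.
  - by rewrite coprimepMr => -> ->.
  - apply/coprimep_expr; rewrite coprimep_XsubC root_XsubC.
    by apply: contraNneq a_rs => <-.
have /Bezout_eq1_coprimepP[[u v] /= Euv] := coprimep_expl m co_q.
exists (p' + q * (v * ((f a)%:P - p'))) => b.
rewrite inE => /predU1P[->|b_rs].
  have -> : p' + q * (v * ((f a)%:P - p')) - (f a)%:P =
            ('X - a%:P) ^+ m * (u * (p' - (f a)%:P)).
    transitivity ((1 - v * q) * (p' - (f a)%:P)); first by ring.
    by rewrite -Euv addrK; ring.
  exact: dvdp_mulr.
rewrite addrAC dvdp_add ?Hp'// dvdp_mulr//.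
by rewrite /q (big_rem b)//= dvdp_mulr.
Qed.

Lemma char_poly_split (F : closedFieldType) n (A : 'M[F]_n.+1) :
  exists2 r : seq F, char_poly A = \prod_(z <- r) ('X - z%:P) & size r = n.+1.
Proof.
have [r Er] := closed_field_poly_normal (char_poly A).
rewrite (monicP (char_poly_monic A)) scale1r in Er; exists r => //.
by apply/eq_add_S; rewrite -(size_prod_XsubC r id) -Er size_char_poly.
Qed.

Lemma jordan_chevalley (F : closedFieldType) n (A : 'M[F]_n.+1) :
  exists p, diagonalizable (horner_mx A p) /\ (A - horner_mx A p) ^+ n.+1 = 0.
Proof.
have [r Er size_r] := char_poly_split A.
have [p Hp] := poly_crt (undup r) id n.+1; exists p.
pose N := \prod_(a <- undup r) ('X - a%:P) ^+ n.+1.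
(* No multiplicity in the characteristic polynomial exceeds n+1, so that polynomial divides [N]. *)
have chN q : N %| q -> horner_mx A q = 0.
  move=> Nq; apply/mxminpoly_minP/(dvdp_trans _ Nq)/(dvdp_trans (mxminpoly_dvd_char A)).
  rewrite Er -prodr_undup_exp_count; elim: (undup r) @N {Hp Nq} => [|a s IH] /=.
    by rewrite !big_nil.
  by rewrite !big_cons dvdp_mul// dvdp_exp2l// -size_r count_size.
split.
  apply/diagonalizableP; exists (undup r); first exact: undup_uniq.
  apply: mxminpoly_min; rewrite rmorph_prod /=.
  transitivity (horner_mx A (\prod_(a <- undup r) (p - a%:P))).
    rewrite rmorph_prod; apply: eq_bigr => a _.
    by rewrite !rmorphB /= horner_mx_X !horner_mx_C.
  apply: chN; rewrite /N big_seq [X in _ %| X]big_seq.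
  by apply: (big_ind2 (fun u v => u %| v)) => // *; exact: dvdp_mul.
have -> : A - horner_mx A p = horner_mx A ('X - p) by rewrite rmorphB /= horner_mx_X.
rewrite -rmorphXn; apply: chN; rewrite /N prodrXl dvdp_exp2r//.
apply: uniq_roots_dvdp; last by rewrite uniq_rootsE undup_uniq.
apply/allP => a a_r.
have : 'X - a%:P %| p - a%:P.
  by apply: dvdp_trans (Hp a a_r); rewrite exprS dvdp_mulr.
by rewrite dvdp_XsubCl !rootE !hornerE !subr_eq0 eq_sym.
Qed.

Lemma nilpotent_char_poly (F : closedFieldType) n (A : 'M[F]_n.+1) m :
  A ^+ m = 0 -> char_poly A = 'X^(n.+1).
Proof.
move=> A0; have [r Er size_r] := char_poly_split A.
have r0 z : z \in r -> z == 0.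
  move=> zr; have : root (char_poly A) z by rewrite Er root_prod_XsubC.
  rewrite -eigenvalue_root_char => /eigenvalueP[v vA v0].
  have vAk k : v *m A ^+ k = z ^+ k *: v.
    elim: k => [|k IH]; first by rewrite !expr0 mulmx1 scale1r.
    by rewrite exprSr mulmxA IH -scalemxAl vA scalerA -exprSr.
  have /esym/eqP := vAk m; rewrite A0 mulmx0 scaler_eq0 (negPf v0) orbF.
  by rewrite expf_eq0 => /andP[].
have /all_pred1P Er0 : all (pred1 0) r by apply/allP.
by rewrite Er Er0 big_nseq subr0 iter_mulr_1 size_r.
Qed.

Lemma mxtrace_nilpotent (F : closedFieldType) n (A : 'M[F]_n.+1) m :
  A ^+ m = 0 -> \tr A = 0.
Proof.
move=> A0; apply: oppr_inj; rewrite -char_poly_trace//.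
by rewrite (nilpotent_char_poly A0) coefXn eqn_leq ltnn andbF oppr0.
Qed.

(** A row [v] killed by 1 + A satisfies v = -vA; iterating this makes [v] vanish. *)
Lemma unitmx1D_nilpotent (F : fieldType) n (A : 'M[F]_n.+1) m :
  A ^+ m = 0 -> 1 + A \in unitmx.
Proof.
move=> A0; rewrite -row_free_unit -kermx_eq0; apply/eqP/row_matrixP => i.
rewrite row0; set v := row i _.
have /eqP : v *m (1 + A) = 0.
  by apply/sub_kermxP; exact: row_sub.
rewrite mulmxDr mulmx1 addr_eq0 => /eqP vA.
have vk k : v = (-1) ^+ k *: (v *m A ^+ k).
  elim: k => [|k IH]; first by rewrite !expr0 mulmx1 scale1r.
  by rewrite exprS -scalerA scaleN1r exprSr -mulmxE mulmxA scalemxAl -IH.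
by rewrite (vk m) A0 mulmx0 scaler0.
Qed.

Lemma diagonalizable_decomp (F : fieldType) n (A : 'M[F]_n) :
  diagonalizable A ->
  exists P d, P \in unitmx /\ A = P *m diag_mx d *m invmx P.
Proof.
case=> P Pu /(diagonalizable_forLR Pu)[d ->].
have uP : invmx P \in unitmx by rewrite unitmx_inv.
by exists (invmx P), d; rewrite (mxpoly.conjumx _ uP).
Qed.

Lemma invmxM (F : fieldType) n (A B : 'M[F]_n.+1) :
  A \in unitmx -> B \in unitmx -> invmx (A *m B) = invmx B *m invmx A.
Proof. exact: invrM. Qed.

(** * Derivations in terms of structure constants *)

(* The notions of the statement over an arbitrary field: unlike [R[i]], an
   abstract field does not get unfolded by unification. *)
Definition stc (F : fieldType) (n : nat) := 'I_n -> 'I_n -> 'cV[F]_n.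

Definition smul (F : fieldType) (n : nat) (mu : stc F n) (X Y : 'cV[F]_n)
  : 'cV[F]_n :=
  \sum_(i < n) \sum_(j < n) (X i 0 * Y j 0) *: mu i j.

Definition sder (F : fieldType) (n : nat) (mu : stc F n) (D : 'M[F]_n) :=
  forall X Y : 'cV[F]_n, D *m smul mu X Y = smul mu (D *m X) Y + smul mu X (D *m Y).

Section StructureConstants.
Variables (F : fieldType) (n : nat).
Implicit Types (mu nu : stc F n) (X Y : 'cV[F]_n) (A B D N P : 'M[F]_n).

Let e (i : 'I_n) : 'cV[F]_n := delta_mx i 0.

Lemma smulDl mu X X' Y : smul mu (X + X') Y = smul mu X Y + smul mu X' Y.
Proof.
rewrite /smul -big_split; apply: eq_bigr => i _ /=; rewrite -big_split.
by apply: eq_bigr => j _ /=; rewrite mxE mulrDl scalerDl.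
Qed.

Lemma smulDr mu X Y Y' : smul mu X (Y + Y') = smul mu X Y + smul mu X Y'.
Proof.
rewrite /smul -big_split; apply: eq_bigr => i _ /=; rewrite -big_split.
by apply: eq_bigr => j _ /=; rewrite mxE mulrDr scalerDl.
Qed.

Lemma smulZl mu a X Y : smul mu (a *: X) Y = a *: smul mu X Y.
Proof.
rewrite /smul scaler_sumr; apply: eq_bigr => i _; rewrite scaler_sumr.
by apply: eq_bigr => j _; rewrite mxE scalerA mulrA.
Qed.

Lemma smulZr mu a X Y : smul mu X (a *: Y) = a *: smul mu X Y.
Proof.
rewrite /smul scaler_sumr; apply: eq_bigr => i _; rewrite scaler_sumr.
by apply: eq_bigr => j _; rewrite mxE scalerA mulrCA.
Qed.

Lemma smulNl mu X Y : smul mu (- X) Y = - smul mu X Y.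
Proof. by rewrite -scaleN1r smulZl scaleN1r. Qed.

Lemma smulNr mu X Y : smul mu X (- Y) = - smul mu X Y.
Proof. by rewrite -scaleN1r smulZr scaleN1r. Qed.

Lemma smul0l mu Y : smul mu 0 Y = 0.
Proof. by have := smulZl mu 0 0 Y; rewrite !scale0r. Qed.

Lemma smul0r mu X : smul mu X 0 = 0.
Proof. by have := smulZr mu 0 X 0; rewrite !scale0r. Qed.

Lemma smul_suml mu I (r : seq I) (v : I -> 'cV[F]_n) Y :
  smul mu (\sum_(i <- r) v i) Y = \sum_(i <- r) smul mu (v i) Y.
Proof.
by apply: (big_morph (smul mu ^~ Y)) => [X X'|]; rewrite ?smulDl ?smul0l.
Qed.

Lemma smul_sumr mu I (r : seq I) (v : I -> 'cV[F]_n) X :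
  smul mu X (\sum_(i <- r) v i) = \sum_(i <- r) smul mu X (v i).
Proof. by apply: (big_morph (smul mu X)) => [Y Y'|]; rewrite ?smulDr ?smul0r. Qed.

Lemma smul_delta mu i j : smul mu (e i) (e j) = mu i j.
Proof.
rewrite /smul (bigD1 i)//= (bigD1 j)//= !mxE !eqxx mulr1 scale1r.
rewrite big1 => [|k kj]; last by rewrite !mxE (negPf kj) mulr0 scale0r.
rewrite addr0 big1 ?addr0// => k ki; rewrite big1// => l _.
by rewrite !mxE (negPf ki) mul0r scale0r.
Qed.

Lemma col_sum_delta X : X = \sum_i X i 0 *: e i.
Proof.
apply/matrixP => k l; rewrite ord1 summxE (bigD1 k)//= !mxE !eqxx mulr1.
by rewrite big1 ?addr0// => j jk; rewrite !mxE eq_sym (negPf jk) mulr0.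
Qed.

Lemma bilinear_ext (f g : 'cV[F]_n -> 'cV[F]_n -> 'cV[F]_n) :
  (forall Y, linear (f^~ Y)) -> (forall X, linear (f X)) ->
  (forall Y, linear (g^~ Y)) -> (forall X, linear (g X)) ->
  (forall i j, f (e i) (e j) = g (e i) (e j)) -> forall X Y, f X Y = g X Y.
Proof.
move=> fl fr gl gr fg X Y.
have lin0 (h : 'cV[F]_n -> 'cV[F]_n) : linear h -> h 0 = 0.
  by move=> hl; have := hl (-1) 0 0; rewrite scaler0 add0r scaleN1r addNr.
have ext (h k : 'cV[F]_n -> 'cV[F]_n) : linear h -> linear k ->
    (forall i, h (e i) = k (e i)) -> h =1 k.
  move=> hl kl hk Z; rewrite (col_sum_delta Z).
  elim/big_rec: _ => [|i x _ IH]; first by rewrite !lin0.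
  by rewrite hl kl hk IH.
apply: (ext (f^~ Y) (g^~ Y)) => // i.
exact: (ext (f (e i)) (g (e i))).
Qed.

Lemma smul_linearl mu Y : linear (smul mu ^~ Y).
Proof. by move=> a X X'; rewrite smulDl smulZl. Qed.

Lemma smul_linearr mu X : linear (smul mu X).
Proof. by move=> a Y Y'; rewrite smulDr smulZr. Qed.

Lemma stc_ext mu nu : (forall X Y, smul mu X Y = smul nu X Y) -> mu = nu.
Proof. by move=> E; apply/funext => i; apply/funext => j; rewrite -!smul_delta E. Qed.

Lemma sderD mu A B : sder mu A -> sder mu B -> sder mu (A + B).
Proof.
by move=> dA dB X Y; rewrite !mulmxDl dA dB smulDl smulDr addrACA.
Qed.

Lemma sderZ mu a A : sder mu A -> sder mu (a *: A).
Proof. by move=> dA X Y; rewrite -!scalemxAl dA smulZl smulZr scalerDr. Qed.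

Lemma sderN mu A : sder mu A -> sder mu (- A).
Proof. by move=> dA; rewrite -scaleN1r; exact: sderZ. Qed.

Lemma sderB mu A B : sder mu A -> sder mu B -> sder mu (A - B).
Proof. by move=> dA dB; apply: sderD => //; exact: sderN. Qed.

Lemma sder0 mu : sder mu 0.
Proof. by move=> X Y; rewrite !mul0mx smul0l smul0r addr0. Qed.

Lemma sder_bracket mu A B :
  sder mu A -> sder mu B -> sder mu (A *m B - B *m A).
Proof.
move=> dA dB X Y; rewrite !mulmxBl -!mulmxA dA dB !mulmxDr !dA !dB.
rewrite smulDl smulDr smulNl smulNr !opprD !addrA.
set a := smul mu (A *m (B *m X)) Y; set b := smul mu (A *m X) (B *m Y).
set c := smul mu (B *m X) (A *m Y); set d := smul mu X (A *m (B *m Y)).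
set f := smul mu (B *m (A *m X)) Y; set g := smul mu X (B *m (A *m Y)).
by apply/matrixP => i j; rewrite !mxE; ring.
Qed.

(** The infinitesimal action of gl_n on structure constants; the derivations of [mu] are the
    matrices that annihilate it. *)
Definition tact A mu : stc F n :=
  fun i j => A *m mu i j - smul mu (A *m e i) (e j) - smul mu (e i) (A *m e j).

Lemma smul_tact A mu X Y :
  smul (tact A mu) X Y = A *m smul mu X Y - smul mu (A *m X) Y - smul mu X (A *m Y).
Proof.
move: X Y; apply: bilinear_ext => *; rewrite ?smul_delta//.
- exact: smul_linearl.
- exact: smul_linearr.
- move=> a X X'; rewrite !(smulDl, smulZl, mulmxDr, =^~ scalemxAr).
  by apply/matrixP => i j; rewrite !mxE; ring.
- move=> a Y Y'; rewrite !(smulDr, smulZr, mulmxDr, =^~ scalemxAr).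
  by apply/matrixP => i j; rewrite !mxE; ring.
Qed.

Lemma tact_comm A B mu :
  A *m B = B *m A -> tact A (tact B mu) = tact B (tact A mu).
Proof.
move=> AB; apply: stc_ext => X Y; rewrite !smul_tact.
rewrite !(mulmxBr, mulmxA) AB.
by apply/matrixP => i j; rewrite !mxE; ring.
Qed.

Lemma der_tactD mu A B : sder mu (A + B) -> tact A mu = tact (- B) mu.
Proof.
move=> dAB; apply: stc_ext => X Y; rewrite !smul_tact.
have := dAB X Y; rewrite !mulmxDl smulDl smulDr => /eqP.
rewrite !mulNmx smulNl smulNr -subr_eq0 => /eqP E.
apply/eqP; rewrite -subr_eq0 -{}E; apply/eqP.
by apply/matrixP => i j; rewrite !mxE; ring.
Qed.

(** [tact N] is a sum of three commuting operators, one on the value and one on each argument. Among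
    3m factors one of them occurs m times; a, b, c count the factors already spent on each. *)
Lemma iter_tact_nilpotent N mu m : (forall k, (m <= k)%N -> N ^+ k = 0) ->
  iter (3 * m) (tact N) mu = fun _ _ => 0.
Proof.
move=> N0; suff H M a b c X Y : (3 * m <= a + b + c + M)%N ->
    N ^+ a *m smul (iter M (tact N) mu) (N ^+ b *m X) (N ^+ c *m Y) = 0.
  apply: stc_ext => X Y; have := H (3 * m)%N 0 0 0 X Y (leqnn _).
  rewrite !expr0 !mul1mx => ->; rewrite /smul big1// => i _; rewrite big1// => j _.
  by rewrite scaler0.
elim: M a b c => [|M IH] a b c abc /=.
  have [ma|am] := leqP m a; first by rewrite N0// mul0mx.
  have [mb|bm] := leqP m b; first by rewrite (N0 b)// mul0mx smul0l mulmx0.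
  by rewrite (N0 c) ?mul0mx ?smul0r ?mulmx0//; lia.
rewrite smul_tact !mulmxBr !mulmxA.
have E k : N ^+ k *m N = N ^+ k.+1 by rewrite exprSr.
have E' k : N *m N ^+ k = N ^+ k.+1 by rewrite exprS.
by rewrite E !E' !IH ?subr0//; lia.
Qed.

Lemma iter_tact_diag (d : 'rV[F]_n) mu m i j k :
  iter m (tact (diag_mx d)) mu i j k 0 =
  (d 0 k - d 0 i - d 0 j) ^+ m * mu i j k 0.
Proof.
elim: m => [|m IH]; first by rewrite expr0 mul1r.
have Ed l : diag_mx d *m e l = d 0 l *: e l.
  apply/matrixP => u v; rewrite mul_diag_mx !mxE; case: eqP => [->|_] //=.
  by rewrite !mulr0.
rewrite /= /tact !Ed smulZl smulZr !smul_delta mul_diag_mx !mxE IH exprS; ring.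
Qed.

Lemma diag_sderP (d : 'rV[F]_n) mu :
  sder mu (diag_mx d) <->
  forall i j k, mu i j k 0 != 0 -> d 0 k = d 0 i + d 0 j.
Proof.
split=> [dd i j k muN0|H X Y].
  have := iter_tact_diag d mu 1 i j k; rewrite /= expr1.
  have -> : tact (diag_mx d) mu = fun _ _ => 0.
    apply: funext => u; apply: funext => v.
    by rewrite -smul_delta smul_tact dd -addrA -opprD subrr.
  rewrite mxE => /esym/eqP; rewrite mulf_eq0 (negPf muN0) orbF -addrA -opprD.
  by rewrite subr_eq0 => /eqP.
apply/eqP; rewrite -subr_eq0 opprD addrA -smul_tact /smul big1// => i _.
rewrite big1// => j _; suff -> : tact (diag_mx d) mu i j = 0 by rewrite scaler0.
apply/matrixP => k l; rewrite ord1 [RHS]mxE; have := iter_tact_diag d mu 1 i j k.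
rewrite /= expr1 => ->; have [->|/H->] := eqVneq (mu i j k 0) 0.
  by rewrite mulr0.
by rewrite -addrA -opprD subrr mul0r.
Qed.

(** The structure constants of [mu] in the basis formed by the columns of [P]. *)
Definition transp P mu : stc F n :=
  fun i j => invmx P *m smul mu (P *m e i) (P *m e j).

Lemma smul_transp P mu X Y :
  smul (transp P mu) X Y = invmx P *m smul mu (P *m X) (P *m Y).
Proof.
move: X Y; apply: bilinear_ext => *; rewrite ?smul_delta//.
- exact: smul_linearl.
- exact: smul_linearr.
- by move=> a X X'; rewrite !(smulDl, smulZl, mulmxDr, =^~ scalemxAr).
- by move=> a Y Y'; rewrite !(smulDr, smulZr, mulmxDr, =^~ scalemxAr).
Qed.

Lemma sder_transp P mu D : P \in unitmx ->
  sder (transp P mu) D <-> sder mu (P *m D *m invmx P).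
Proof.
move=> Pu; split=> dD X Y.
  have := dD (invmx P *m X) (invmx P *m Y).
  rewrite !smul_transp !mulKVmx// !mulmxA.
  move/(congr1 (mulmx P)); rewrite !mulmxA mulmxDr !mulmxA !mulmxV// !mul1mx.
  by move=> ->.
rewrite !smul_transp -mulmxDr.
have := dD (P *m X) (P *m Y); rewrite -!mulmxA !mulKmx// => <-.
by rewrite mulKmx.
Qed.

(* [mu] is killed by the sum of the commuting operators [tact (diag_mx d)] and
   [tact N'], the second one nilpotent: hence it is killed by a power of the
   first one, which is diagonal. *)
Lemma sder_jordan mu P (d : 'rV[F]_n) N m : P \in unitmx ->
  let S := P *m diag_mx d *m invmx P in
  S *m N = N *m S -> (forall k, (m <= k)%N -> N ^+ k = 0) -> sder mu (S + N) ->
  forall i j k, transp P mu i j k 0 != 0 -> d 0 k = d 0 i + d 0 j.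
Proof.
move=> Pu S; have ES : S = P *m diag_mx d *m invmx P by [].
clearbody S => SN N0 dSN i j k nz.
pose N' := invmx P *m N *m P.
have EN l : N' ^+ l = invmx P *m N ^+ l *m P.
  elim: l => [|l IH]; first by rewrite !expr0 mulmx1 mulVmx.
  by rewrite !exprS IH -!mulmxE /N' !mulmxA mulmxK.
have N'0 l : (m <= l)%N -> (- N') ^+ l = 0.
  by move=> ml; rewrite exprNn EN N0// mulmx0 mul0mx mulr0.
have dN : sder (transp P mu) (diag_mx d + N').
  by apply/sder_transp => //; rewrite mulmxDr mulmxDl -ES /N' !mulmxA mulmxV// mul1mx mulmxK.
have cDN : diag_mx d *m (- N') = - N' *m diag_mx d.
  have -> : diag_mx d = invmx P *m S *m P by rewrite ES !mulmxA mulVmx// mul1mx mulmxKV.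
  by rewrite mulmxN mulNmx /N' !mulmxA !mulmxK// -(mulmxA _ S) SN mulmxA.
have := iter_tact_diag d (transp P mu) (3 * m) i j k.
(* The two actions agree on [transp P mu] and commute, so their iterates agree there too. *)
have -> : iter (3 * m) (tact (diag_mx d)) (transp P mu) = iter (3 * m) (tact (- N')) (transp P mu).
  elim: (3 * m)%N => [|l IH]; first by [].
  rewrite [RHS]iterS -IH iterSr (der_tactD dN).
  by elim: l {IH} => [|l IH]; [|rewrite !iterS IH tact_comm].
rewrite iter_tact_nilpotent// mxE => /esym/eqP; rewrite mulf_eq0 (negPf nz) orbF.
rewrite expf_eq0 => /andP[_].
by rewrite -addrA -opprD subr_eq0 => /eqP.
Qed.
End StructureConstants.

(** * The rational projection *)

Section WeightLattice.
Variable n : nat.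
Implicit Type S : {set 'I_n * 'I_n * 'I_n}.

Definition compat (F : fieldType) S (d : 'rV[F]_n) :=
  forall i j k, (i, j, k) \in S -> d 0 k = d 0 i + d 0 j.

(** Positive definiteness over the rationals: if u kills the Gram matrix, the squares of the entries
    of uK sum to zero. *)
Lemma gram_unitmx r (K : 'M[rat]_(r, n)) : row_free K -> K *m K^T \in unitmx.
Proof.
move=> Kfree; rewrite -row_free_unit -kermx_eq0; apply/eqP/row_matrixP => i.
rewrite row0; set u := row i _.
have /sub_kermxP uG : (u <= kermx (K *m K^T))%MS by exact: row_sub.
suff /eqP : u *m K = 0 by rewrite mulmx_free_eq0// => /eqP.
have : (u *m K) *m (u *m K)^T = 0 by rewrite trmx_mul mulmxA -(mulmxA u) uG mul0mx.
move: (u *m K) => w /matrixP/(_ 0 0); rewrite !mxE => /eqP.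
rewrite psumr_eq0 => [/allP w0|k _]; last by rewrite mxE -expr2 sqr_ge0.
apply/rowP => k; have := w0 k (mem_index_enum k).
by rewrite !mxE mulf_eq0 orbb => /eqP.
Qed.

(* [q] is the orthogonal projection of (1,...,1) onto the space of weights
   compatible with [S]; it is rational because that space is defined over Q. *)
Lemma compat_proj S : exists q : 'rV[rat]_n, compat S q /\
  forall (F : numFieldType) (v : 'rV[F]_n), compat S v ->
    \sum_k v 0 k * ratr (q 0 k) = \sum_k v 0 k.
Proof.
(* Each column is one equation d_k - d_i - d_j = 0, replaced by 0 = 0 for triples outside [S]. *)
pose A : 'M[rat]_(n, #|{: 'I_n * 'I_n * 'I_n}|) := \matrix_(l, t)
  let x := enum_val t in
  (x \in S)%:R * ((l == x.2)%:R - (l == x.1.1)%:R - (l == x.1.2)%:R).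
have AP (F : numFieldType) (v : 'rV[F]_n) :
    v *m map_mx (ratr : rat -> F) A = 0 <-> compat S v.
  have E t : (v *m map_mx (ratr : rat -> F) A) 0 t = let x := enum_val t in
      (x \in S)%:R * (v 0 x.2 - v 0 x.1.1 - v 0 x.1.2).
    rewrite mxE /=; set x := enum_val t.
    have sel (y : 'I_n) : \sum_k v 0 k * (k == y)%:R = v 0 y.
      rewrite (bigD1 y)//= eqxx mulr1 big1 ?addr0// => k /negPf->.
      by rewrite mulr0.
    rewrite -!sel -!sumrB mulr_sumr; apply: eq_bigr => k _.
    by rewrite !mxE rmorphM !rmorphB /= !ratr_nat -/x; ring.
  split=> [/rowP vA i j k ijkS|vS].
    have := vA (enum_rank (i, j, k)); rewrite E /= enum_rankK ijkS mul1r mxE /=.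
    by move/eqP; rewrite -addrA -opprD subr_eq0 => /eqP.
  apply/rowP => t; rewrite E mxE /=; case: (enum_val t) => -[i j] k /=.
  have [ijkS|_] := boolP (_ \in S); last by rewrite mul0r.
  by rewrite (vS i j k)// -addrA -opprD subrr mulr0.
pose K := row_base (kermx A).
have G_unit : K *m K^T \in unitmx by apply: gram_unitmx; exact: row_base_free.
have KA : K *m A = 0 by apply/sub_kermxP; rewrite eq_row_base.
(* The usual projector onto the row space of [K], applied to the all-ones vector. *)
pose q : 'rV[rat]_n := (K^T *m invmx (K *m K^T) *m K *m const_mx 1)^T.
have rat_id (m p : nat) (B : 'M[rat]_(m, p)) : map_mx (ratr : rat -> rat) B = B.
  by apply/matrixP => i j; rewrite mxE /ratr divq_num_den.
exists q; split=> [|F v vS].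
  apply/AP; rewrite rat_id; apply: trmx_inj.
  by rewrite trmx_mul trmxK !mulmxA -trmx_mul KA !trmx0 !mul0mx.
(* Kernels commute with field extension, so the rational basis [K] still spans the compatible
   weights over [F]. *)
have /submxP[w Ew] : (v <= map_mx (ratr : rat -> F) K)%MS.
  have vker : (v <= map_mx (ratr : rat -> F) (kermx A))%MS.
    by rewrite map_kermx; apply/sub_kermxP/AP.
  by apply: submx_trans vker _; rewrite map_submx eq_row_base.
have : v *m (map_mx (ratr : rat -> F) q)^T = v *m const_mx 1.
  rewrite -map_trmx trmxK !map_mxM /= Ew -!mulmxA; congr (_ *m _).
  rewrite !mulmxA -!map_mxM mulmxV// mul1mx map_mxM; congr (_ *m _).
  by apply/matrixP => i j; rewrite !mxE rmorph1.
move/matrixP/(_ 0 0); rewrite !mxE => E.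
transitivity (\sum_k v 0 k * (map_mx (ratr : rat -> F) q)^T k 0).
  by apply: eq_bigr => k _; rewrite !mxE.
by rewrite E; apply: eq_bigr => k _; rewrite mxE mulr1.
Qed.
End WeightLattice.

(** * Existence and rationality *)

Definition lin_closed (F : fieldType) n (U : 'M[F]_n -> Prop) :=
  [/\ U 0, forall A B, U A -> U B -> U (A + B) & forall a A, U A -> U (a *: A)].

(* [x] and [psi0] are polynomials in [ad phi] applied to [psi], so they stay in
   every [ad phi]-stable subspace. *)
Lemma ad_split (F : fieldType) n (P : 'M[F]_n) (d : 'rV[F]_n) (U : 'M[F]_n -> Prop) :
  let phi := P *m diag_mx d *m invmx P in
  P \in unitmx -> lin_closed U ->
  (forall A, U A -> U (phi *m A - A *m phi)) ->
  forall psi, U psi -> exists psi0 x, [/\ U psi0, U x,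
    psi = psi0 + (x *m phi - phi *m x) & phi *m psi0 = psi0 *m phi].
Proof.
move=> phi Pu [U0 UD UZ] Uad psi Upsi.
pose ad A := phi *m A - A *m phi.
pose cj A := invmx P *m A *m P.
have cj_inj A B : cj A = cj B -> A = B.
  move=> /(congr1 (fun C => P *m C *m invmx P)).
  by rewrite /cj !mulmxA mulmxV// !mul1mx !mulmxK.
have cj_ad A i j : cj (ad A) i j = (d 0 i - d 0 j) * cj A i j.
  have -> : cj (ad A) = diag_mx d *m cj A - cj A *m diag_mx d.
    by rewrite /cj /ad mulmxBr mulmxBl /phi !mulmxA mulVmx// mul1mx mulmxKV.
  by rewrite mul_diag_mx mul_mx_diag !mxE; ring.
have cjD A B : cj (A + B) = cj A + cj B by rewrite /cj mulmxDr mulmxDl.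
have cjZ a A : cj (a *: A) = a *: cj A by rewrite /cj -scalemxAr -scalemxAl.
have U_iter k : U (iter k ad psi) by elim: k => //= k; exact: Uad.
have cj_iter k i j : cj (iter k ad psi) i j = (d 0 i - d 0 j) ^+ k * cj psi i j.
  elim: k => [|k IH]; first by rewrite expr0 mul1r.
  by rewrite iterS cj_ad IH exprS mulrA.
(* [p] inverts -(ad phi) on its nonzero eigenvalues d_i - d_j. Since 0^-1 = 0, it sends the
   eigenvalue 0 to 0. Hence psi + ad x keeps exactly the part of psi that commutes with phi. *)
have [p Hp] := poly_crt [seq d 0 ij.1 - d 0 ij.2 | ij : 'I_n * 'I_n] (fun a => - a^-1) 1.
pose x := \sum_(k < size p) p`_k *: iter k ad psi.
have cj_x i j : cj x i j = - (d 0 i - d 0 j)^-1 * cj psi i j.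
  have <- : p.[d 0 i - d 0 j] = - (d 0 i - d 0 j)^-1.
    have := Hp (d 0 i - d 0 j) (map_f (fun ij => _ - _) (mem_enum predT (i, j))).
    rewrite expr1 dvdp_XsubCl rootE !hornerE subr_eq0 => /eqP; exact.
  rewrite horner_coef mulr_suml /x.
  rewrite (big_morph cj cjD (_ : cj 0 = 0)); last by rewrite /cj mulmx0 mul0mx.
  rewrite summxE; apply: eq_bigr => k _.
  by rewrite cjZ mxE cj_iter mulrA.
have Ux : U x by apply: big_ind => // k _; exact: UZ.
exists (psi + ad x), x; split=> //.
- by apply: UD => //; exact: Uad.
- by rewrite -[LHS]addr0 -addrA; congr (_ + _); rewrite addrC /ad addrA subrK subrr.
- apply/eqP; rewrite -subr_eq0; apply/eqP/cj_inj/matrixP => i j.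
  rewrite -/(ad _) cj_ad cjD mxE cj_ad cj_x /cj mulmx0 mul0mx !mxE.
  have [->|nz] := eqVneq (d 0 i - d 0 j) 0; first by rewrite mul0r.
  by rewrite mulNr mulrN mulrA mulfV// mul1r subrr mulr0.
Qed.

Lemma ratr_real (F : numFieldType) (q : rat) : (ratr q : F) \is Num.real.
Proof. by rewrite /ratr realM ?realV ?realz. Qed.

Section Nikolayevsky.
Variables (C : numClosedFieldType) (n : nat).
Implicit Types (mu : stc C n.+1) (phi psi P : 'M[C]_n.+1) (d : 'rV[C]_n.+1).

Definition snik mu phi :=
  [/\ sder mu phi,
      exists P d, [/\ P \in unitmx, forall k, d 0 k \is Num.real &
                      phi = P *m diag_mx d *m invmx P] &
      forall psi, sder mu psi -> \tr (phi *m psi) = \tr psi].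

Definition supp mu : {set 'I_n.+1 * 'I_n.+1 * 'I_n.+1} :=
  [set x | mu x.1.1 x.1.2 x.2 0 != 0].

Lemma sder_diagP mu P d : P \in unitmx ->
  sder mu (P *m diag_mx d *m invmx P) <-> compat (supp (transp P mu)) d.
Proof.
move=> Pu; split.
  by move/(sder_transp _ _ Pu)/diag_sderP => H i j k; rewrite inE; exact: H.
move=> H; apply/(sder_transp _ _ Pu)/diag_sderP => i j k nz.
by apply: H; rewrite inE.
Qed.

Lemma tr_conj_diag P d e : P \in unitmx ->
  \tr (P *m diag_mx d *m invmx P *m (P *m diag_mx e *m invmx P)) =
  \sum_k e 0 k * d 0 k.
Proof.
move=> Pu; rewrite !mulmxA mulmxKV// mxtrace_mulC !mulmxA mulVmx// mul1mx.
rewrite mulmx_diag mxtrace_diag; apply: eq_bigr => k _.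
by rewrite mxE mulrC.
Qed.

Lemma tr_diag_conj P d : P \in unitmx ->
  \tr (P *m diag_mx d *m invmx P) = \sum_k d 0 k.
Proof. by move=> Pu; rewrite mxtrace_mulC mulmxA mulVmx// mul1mx mxtrace_diag. Qed.

Lemma sum_sqr_eq0 (d : 'rV[C]_n.+1) : (forall k, d 0 k \is Num.real) ->
  \sum_k d 0 k * d 0 k = 0 -> d = 0.
Proof.
move=> dR /eqP; rewrite psumr_eq0 => [/allP H|k _]; last first.
  by rewrite -expr2 real_exprn_even_ge0.
apply/rowP => k; have := H k (mem_index_enum k).
by rewrite mulf_eq0 orbb mxE => /eqP.
Qed.

(* [d] equals the rational projection: their difference is compatible with the
   support, hence orthogonal to itself. *)
Lemma snik_rational mu P d : P \in unitmx -> (forall k, d 0 k \is Num.real) ->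
  (forall psi, sder mu psi -> \tr (P *m diag_mx d *m invmx P *m psi) = \tr psi) ->
  sder mu (P *m diag_mx d *m invmx P) -> exists q : 'rV[rat]_n.+1, d = map_mx ratr q.
Proof.
move=> Pu dR trd dd; have [q [Sq proj_q]] := compat_proj (supp (transp P mu)).
exists q; apply/eqP; rewrite -subr_eq0; apply/eqP.
apply: sum_sqr_eq0 => [k|]; first by rewrite !mxE realB ?dR ?ratr_real.
set v := d - _; have Sv : compat (supp (transp P mu)) v.
  move=> i j k ijk; rewrite !mxE (Sq i j k)// rmorphD /=.
  by rewrite ((sder_diagP mu d Pu).1 dd i j k)//; ring.
have := trd _ ((sder_diagP mu v Pu).2 Sv).
rewrite tr_conj_diag// tr_diag_conj// -(proj_q _ _ Sv) => /eqP.
rewrite -subr_eq0 -sumrB => /eqP; apply: etrans; apply: eq_bigr => k _.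
by rewrite !mxE; ring.
Qed.

Lemma lin_closed_sder mu : lin_closed (sder mu).
Proof.
by split; [exact: sder0|move=> *; exact: sderD|move=> *; exact: sderZ].
Qed.

Lemma snik_exists mu : exists phi, snik mu phi.
Proof.
pose q (S : {set 'I_n.+1 * 'I_n.+1 * 'I_n.+1}) := projT1 (cid (@compat_proj n.+1 S)).
have Sq S : compat S (q S) by have [] := projT2 (cid (@compat_proj n.+1 S)).
have proj_q S (F : numFieldType) v : compat S v ->
    \sum_k v 0 k * ratr (q S 0 k) = \sum_k v 0 k :> F.
  by have [_] := projT2 (cid (@compat_proj n.+1 S)); exact.
(* Supersets of supports are allowed too, so that [setT] can start the search for a maximum. *)
pose realizable (S : {set 'I_n.+1 * 'I_n.+1 * 'I_n.+1}) := `[< exists2 P, P \in unitmx & supp (transp P mu) \subset S >].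
have : realizable setT by apply/asboolP; exists 1%:M; rewrite ?unitmx1 ?subsetT.
pose val (S : {set 'I_n.+1 * 'I_n.+1 * 'I_n.+1}) := \sum_k q S 0 k.
move=> /(Order.TotalTheory.arg_maxP val)[S /asboolP[P Pu PS] S_max].
(* The projection satisfies q.q = q.1, so [val] is its squared norm. *)
have val_sqr S' : \sum_k q S' 0 k * q S' 0 k = val S'.
  rewrite /val -(proj_q S' _ (q S') (Sq S')).
  by apply: eq_bigr => k _; rewrite /ratr divq_num_den.
have ratr_compat S' (v : 'rV[rat]_n.+1) : compat S' v -> compat S' (map_mx (ratr : rat -> C) v).
  by move=> vS i j k ijk; rewrite !mxE (vS i j k)// rmorphD.
pose d : 'rV[C]_n.+1 := map_mx ratr (q S); pose phi := P *m diag_mx d *m invmx P.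
have dphi : sder mu phi.
  apply/(sder_diagP mu d Pu) => i j k ijk.
  by apply: ratr_compat (Sq S) _ _ _ _; exact: (subsetP PS).
exists phi; split => //.
  by exists P, d; split=> // k; rewrite mxE ratr_real.
move=> psi dpsi.
have [psi0 [x [dpsi0 dx -> comm0]]] := ad_split Pu (lin_closed_sder mu)
  (fun A dA => sder_bracket dphi dA) dpsi.
rewrite -/phi in comm0 *; clear dpsi psi.
(* The discarded commutator [x, phi] has trace zero, alone and against phi. *)
transitivity (\tr (phi *m psi0)).
  rewrite mulmxDr mxtraceD mulmxBr raddfB /= [\tr (phi *m (phi *m x))]mxtrace_mulC.
  by rewrite -(mulmxA phi x phi) subrr addr0.
transitivity (\tr psi0); last first.
  by rewrite mxtraceD raddfB /= (mxtrace_mulC x) subrr addr0.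
have [p [Sdiag N0]] := jordan_chevalley psi0.
set s := horner_mx psi0 p in Sdiag N0; set N := psi0 - s in N0.
have comm_phi_s : comm_mx phi s by apply: comm_mx_horner.
have comm_s_psi0 : comm_mx s psi0 by apply: comm_horner_mx.
have comm_s_N : s *m N = N *m s.
  by rewrite /N mulmxBr mulmxBl comm_s_psi0.
have comm_phi_N : phi * N = N * phi.
  by rewrite -!mulmxE /N mulmxBr mulmxBl comm0 comm_phi_s.
have Nk k : (n.+1 <= k)%N -> N ^+ k = 0.
  by move=> nk; rewrite -(subnK nk) exprD N0 mulr0.
have phi_diag : diagonalizable phi.
  exists (invmx P); first by rewrite unitmx_inv.
  by apply/diagonalizable_forLR; rewrite ?unitmx_inv//; exists d; rewrite invmxK mxpoly.conjumx.
have [Q0 Q0u /= /and3P[]] : codiagonalizable [:: phi; s].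
  apply/codiagonalizableP; split=> [A B|A]; rewrite !inE.
    by move=> /orP[]/eqP-> /orP[]/eqP->.
  by move/orP => []/eqP->.
move=> /(diagonalizable_forLR Q0u)[a Ea] /(diagonalizable_forLR Q0u)[b Eb] _.
pose Q := invmx Q0; have Qu : Q \in unitmx by rewrite unitmx_inv.
rewrite (mxpoly.conjumx _ Qu) -/Q in Ea; rewrite (mxpoly.conjumx _ Qu) -/Q in Eb.
have ds : compat (supp (transp Q mu)) b.
  move=> i j k; rewrite inE; apply: (sder_jordan Qu _ Nk).
    by rewrite -Eb.
  by rewrite -Eb /N addrC subrK.
have da : compat (supp (transp Q mu)) a by apply/(sder_diagP mu a Qu); rewrite -Ea.
set S' := supp _ in ds da.
(* If phi is the projection in the new basis, tr(phi s) = b.q = b.1 = tr s; [N] and phi N are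
   nilpotent and contribute nothing. *)
suff Ea' : a = map_mx ratr (q S').
  have Epsi0 : psi0 = s + N by rewrite /N addrC subrK.
  have trN : \tr N = 0 by exact: mxtrace_nilpotent N0.
  have trphiN : \tr (phi *m N) = 0.
    by apply: (@mxtrace_nilpotent _ _ _ n.+1); rewrite exprMn_comm// N0 mulr0.
  rewrite Epsi0 mulmxDr (mxtraceD (phi *m s)) (mxtraceD s) trN trphiN !addr0.
  rewrite Ea Eb tr_conj_diag// tr_diag_conj// -(proj_q S' C b ds) Ea'.
  by apply: eq_bigr => k _; rewrite mxE.
(* [W] intertwines the two diagonal forms of phi. A nonzero entry in its column k identifies a_k
   with some rational d_i. *)
have a_rat k : exists r : rat, a 0 k = ratr r.
  pose W := invmx P *m Q.
  have EW : diag_mx d *m W = W *m diag_mx a.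
    have := congr1 (fun A => invmx P *m A *m Q) Ea.
    by rewrite /phi /W !mulmxA mulVmx// mul1mx mulmxKV.
  have /existsP[i Wik] : [exists i, W i k != 0].
    apply: contraT; rewrite negb_exists => /forallP W0.
    have : W *m delta_mx k (0 : 'I_1) = 0.
      apply/colP => i; rewrite mxE [RHS]mxE; apply: big1 => j _.
      rewrite [delta_mx _ _ _ _]mxE eqxx andbT; case: eqP => [->|_]; last by rewrite mulr0.
      by have := W0 i; rewrite negbK => /eqP->; rewrite mul0r.
    move/(congr1 (mulmx (invmx W))); rewrite mulmx0 mulKmx; last first.
      by rewrite unitmx_mul unitmx_inv Pu.
    by move/colP/(_ k)/eqP; rewrite !mxE !eqxx oner_eq0.
  exists (q S 0 i); have := congr1 (fun A : 'M_n.+1 => A i k) EW.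
  rewrite mul_diag_mx mul_mx_diag mxE [RHS]mxE mulrC => E.
  by apply: (mulfI Wik); rewrite -E /d [map_mx _ _ _ _]mxE.
pose a' : 'rV[rat]_n.+1 := \row_k projT1 (cid (a_rat k)).
have Ea' : a = map_mx ratr a'.
  by apply/rowP => k; rewrite !mxE; case: cid.
have inj_ratr : injective (ratr : rat -> C) by exact: fmorph_inj.
have Sa' : compat S' a'.
  move=> i j k ijk; apply: inj_ratr; rewrite rmorphD /=.
  by have := da i j k ijk; rewrite Ea' !mxE.
have sum_a' : \sum_k a' 0 k = val S.
  apply: inj_ratr; rewrite !rmorph_sum /=.
  transitivity (\tr phi).
    by rewrite Ea tr_diag_conj// Ea'; apply: eq_bigr => k _; rewrite !mxE.
  by rewrite tr_diag_conj//; apply: eq_bigr => k _; rewrite !mxE.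
have sum_a'2 : \sum_k a' 0 k * a' 0 k = val S.
  rewrite -val_sqr; apply: inj_ratr; rewrite !rmorph_sum /=.
  transitivity (\tr (phi *m phi)).
    by rewrite Ea tr_conj_diag// Ea'; apply: eq_bigr => k _; rewrite !mxE rmorphM.
  by rewrite tr_conj_diag//; apply: eq_bigr => k _; rewrite !mxE rmorphM.
have sum_a'q : \sum_k a' 0 k * q S' 0 k = val S.
  rewrite -sum_a' -(proj_q S' _ a' Sa').
  by apply: eq_bigr => k _; rewrite /ratr divq_num_den.
(* Traces do not depend on the basis, so a'.a' = a'.1 = [val S], and a'.q = a'.1 by projection.
   Maximality of [val S] then leaves no room for a positive distance. *)
have dist : \sum_k (a' 0 k - q S' 0 k) ^+ 2 = val S' - val S.
  transitivity (\sum_k a' 0 k * a' 0 k - (\sum_k a' 0 k * q S' 0 k) *+ 2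
                + \sum_k q S' 0 k * q S' 0 k).
    by rewrite -sumrMnl -sumrB -big_split; apply: eq_bigr => k _ /=; ring.
  by rewrite sum_a'2 sum_a'q val_sqr; ring.
have : \sum_k (a' 0 k - q S' 0 k) ^+ 2 == 0.
  rewrite eq_le sumr_ge0 => [|k _]; last exact: sqr_ge0.
  by rewrite dist subr_le0 andbT; apply: S_max; apply/asboolP; exists Q.
rewrite psumr_eq0 => [/allP H|k _]; last exact: sqr_ge0.
rewrite Ea'; congr map_mx; apply/rowP => k.
have := H k (mem_index_enum k); rewrite expf_eq0 subr_eq0 => /eqP; exact.
Qed.
End Nikolayevsky.

(** * Engel's theorem *)

Section Filtration.
Variables (F : fieldType) (n : nat).
Implicit Types (L : 'M[F]_n -> Prop) (A x y z : 'M[F]_n) (v w : 'cV[F]_n).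

(* The vectors killed by every product of [j] elements of [L]. *)
Fixpoint kfil L j v : Prop :=
  if j is j'.+1 then forall x, L x -> kfil L j' (x *m v) else v = 0.

Lemma kfil0 L j : kfil L j 0.
Proof. by elim: j => //= j IH x _; rewrite mulmx0. Qed.

Lemma kfilD L j v w : kfil L j v -> kfil L j w -> kfil L j (v + w).
Proof.
elim: j v w => [|j IH] v w /=; first by move=> -> ->; rewrite addr0.
by move=> Kv Kw x Lx; rewrite mulmxDr; apply: IH; [exact: Kv|exact: Kw].
Qed.

Lemma kfilZ L j a v : kfil L j v -> kfil L j (a *: v).
Proof.
elim: j v => [|j IH] v /=; first by move=> ->; rewrite scaler0.
by move=> Kv x Lx; rewrite -scalemxAr; apply: IH; exact: Kv.
Qed.

Lemma kfilB L j v w : kfil L j v -> kfil L j w -> kfil L j (v - w).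
Proof. by move=> Kv Kw; apply: kfilD => //; rewrite -scaleN1r; exact: kfilZ. Qed.

Lemma kfil_le L j k v : (j <= k)%N -> kfil L j v -> kfil L k v.
Proof.
have step l u : kfil L l u -> kfil L l.+1 u.
  elim: l u => [|l IH] u; first by move=> -> x _; rewrite mulmx0.
  by move=> Ku x Lx; apply: IH; exact: Ku.
move=> jk Kv; rewrite -(subnK jk); elim: (k - j)%N => // i IH.
exact: step.
Qed.

Lemma kfil_sub L L' j v :
  (forall x, L x -> L' x) -> kfil L' j v -> kfil L j v.
Proof.
move=> LL'; elim: j v => //= j IH v Kv x Lx.
by apply: IH; apply: Kv; exact: LL'.
Qed.

(** Since xA = Ax - [A,x], a matrix normalising [L] preserves its filtration. *)
Lemma kfil_stable L A j v : (forall x, L x -> L (A *m x - x *m A)) ->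
  kfil L j v -> kfil L j (A *m v).
Proof.
move=> LA; elim: j v => [|j IH] v /=; first by move=> ->; rewrite mulmx0.
move=> Kv x Lx.
have -> : x *m (A *m v) = A *m (x *m v) - (A *m x - x *m A) *m v.
  by rewrite mulmxBl !mulmxA opprB addrC subrK.
apply: kfilB; first by apply: IH; exact: Kv.
by apply: Kv; exact: LA.
Qed.

Section Engel.
Variables (L : 'M[F]_n -> Prop) (N : nat).
Hypotheses (L_lin : lin_closed L)
  (L_lie : forall x y, L x -> L y -> L (x *m y - y *m x))
  (L_nil : forall x, L x -> x ^+ N = 0).

(** Subalgebras of [L] for which Engel's conclusion is already known. Being genuine subspaces, they
    have a dimension to induct on. *)
Let good (U : {vspace 'M[F]_n}) := [/\ forall x, x \in U -> L x,
  forall x y, x \in U -> y \in U -> x *m y - y *m x \in U &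
  exists m, forall v, kfil (fun x => x \in U) m v].

Lemma engel_normalizer U y : good U -> L y -> y \notin U ->
  exists x, [/\ L x, x \notin U & forall u, u \in U -> u *m x - x *m u \in U].
Proof.
move=> [UL _ [m Km]] Ly yU; apply: contrapT => noex.
(* [G d z]: z lowers the filtration by at least d - m levels. This is automatic for d = 0, as level
   m is the whole space. If nothing outside [U] normalised it, bracketing with [U] could raise d
   forever while staying outside [U]; but d = 2m forces z = 0. *)
pose G d z := forall a b v, (a + m <= b + d)%N ->
  kfil (fun x => x \in U) a v -> kfil (fun x => x \in U) b (z *m v).
suff H d : exists z, [/\ L z, z \notin U & G d z].
  have [z [_ zU Gz]] := H (m + m)%N; suff z0 : z = 0 by rewrite z0 mem0v in zU.
  apply/matrixP => i j; have : z *m delta_mx j (0 : 'I_1) = 0.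
    by apply: (Gz m 0%N).
  by rewrite -colE => /colP/(_ i); rewrite !mxE.
elim: d => [|d [z [Lz zU Gz]]].
  exists y; split=> // a b v ab _; apply: (@kfil_le _ m) (Km _); lia.
have [u uU uzU] : exists2 u, u \in U & u *m z - z *m u \notin U.
  apply: contrapT => H; apply: noex; exists z; split=> // u uU.
  by apply: contrapT => /negP uzU; apply: H; exists u.
exists (u *m z - z *m u); split=> // [|a b v ab Kv].
  by apply: L_lie => //; exact: UL.
rewrite mulmxBl -!mulmxA; apply: kfilB.
  have : kfil (fun x => x \in U) b.+1 (z *m v) by apply: Gz Kv; lia.
  exact.
case: a ab Kv => [|a] ab Kv; first by rewrite Kv !mulmx0; exact: kfil0.
by apply: (Gz a); [lia|exact: Kv].
Qed.

Lemma engel_extend U x : good U -> L x ->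
  (forall u, u \in U -> u *m x - x *m u \in U) -> good (U + <[x]>)%VS.
Proof.
have [L0 LD LZ] := L_lin; move=> [UL U_lie [m Km]] Lx Ux; split.
- move=> _ /memv_addP[u uU [_ /vlineP[a ->] ->]].
  by apply: LD; [exact: UL|exact: LZ].
- move=> y z /memv_addP[u uU [_ /vlineP[a ->] ->]].
  move=> /memv_addP[u' u'U [_ /vlineP[b ->] ->]].
  apply: (subvP (addvSl U _)).
  have -> : (u + a *: x) *m (u' + b *: x) - (u' + b *: x) *m (u + a *: x) =
    (u *m u' - u' *m u) + b *: (u *m x - x *m u) - a *: (u' *m x - x *m u').
    rewrite !(mulmxDl, mulmxDr, =^~ scalemxAl, =^~ scalemxAr) !scalerA.
    rewrite [b * a]mulrC !scalerBr.
    by apply/matrixP => i j; rewrite !mxE; ring.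
  apply: rpredB; last by apply: rpredZ; exact: Ux.
  by apply: rpredD; [exact: U_lie|apply: rpredZ; exact: Ux].
(* Level j for [U] lies in level jN for the extension: [U] lowers the level, while x preserves it
   and acts at most N - 1 times in a row without giving zero. The inner induction is on i with x^i v
   = 0. *)
exists (m * N)%N => v; move: (Km v); elim: m {Km} v => [|j IH] v /=.
  by [].
move=> Kv; rewrite mulSn addnC; move: (j * N)%N IH => jN IH.
have : x ^+ N *m v = 0 by rewrite L_nil// mul0mx.
have : kfil (fun x => x \in U) j.+1 v by [].
elim: N v {Kv} => [|i IHi] v Kv xv.
  by move: xv; rewrite expr0 mul1mx => ->; exact: kfil0.
rewrite addnS => z /memv_addP[u uU [_ /vlineP[a ->] ->]].
rewrite mulmxDl -scalemxAl; apply: kfilD.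
  by apply: kfil_le (IH _ (Kv u uU)); rewrite ?leq_addr.
apply: kfilZ; apply: IHi; last by rewrite mulmxA -[_ *m x]exprSr.
apply: kfil_stable Kv => w wU; rewrite -opprB rpredN; exact: Ux.
Qed.

(** Starting from 0, a good subalgebra is enlarged by a normalising element until it contains [L];
    its codimension drops each time. *)
Theorem engel : exists m, forall v, kfil L m v.
Proof.
have good0 : good 0%VS.
  have [L0 _ _] := L_lin; split.
  - by move=> x; rewrite memv0 => /eqP->.
  - by move=> x y; rewrite !memv0 => /eqP-> /eqP->; rewrite mul0mx subrr.
  - by exists 1%N => v /= x; rewrite memv0 => /eqP->; rewrite mul0mx.
move: (0%VS) good0 => U; have [k] := ubnP (\dim {:'M[F]_n} - \dim U).
elim: k U => // k IH U dimU gU; have [UL _ [m Km]] := gU.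
have [LU|] := pselect (forall y, L y -> y \in U).
  by exists m => v; exact: kfil_sub (Km v).
move=> /existsNP[y /not_implyP[Ly /negP yU]].
have [x [Lx xU Ux]] := engel_normalizer gU Ly yU.
apply: (IH (U + <[x]>)%VS); last exact: engel_extend.
have UU' : (U <= U + <[x]>)%VS by exact: addvSl.
have ltU : (\dim U < \dim (U + <[x]>))%N.
  rewrite ltn_neqAle dimvS// andbT; apply: contra xU => /eqP dUU'.
  have /eqP -> : U == (U + <[x]>)%VS by rewrite eqEdim UU' dUU' leqnn.
  exact: (subvP (addvSr U _) _ (memv_line x)).
have := dimvS (subvf (U + <[x]>)%VS); lia.
Qed.
End Engel.
End Filtration.

(** * Exponentials of derivations *)

Section Exponential.
Variables (F : numFieldType) (n : nat).
Implicit Types (mu : stc F n.+1) (x : 'M[F]_n.+1) (X Y : 'cV[F]_n.+1).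

Definition saut mu (g : 'M[F]_n.+1) := g \in unitmx /\
  forall X Y, g *m smul mu X Y = smul mu (g *m X) (g *m Y).

(** Divided powers, which remove the binomial coefficients from Leibniz's rule. *)
Let dp x i := (i`!%:R : F)^-1 *: x ^+ i.

(* When x^(n+1) = 0 this is exp(x); with this bound on the exponents no product of
   two nonzero terms is lost in [expmx_saut]. *)
Definition expmx x := \sum_(i < (2 * n).+2) dp x i.

Lemma dpS x i : x *m dp x i = i.+1%:R *: dp x i.+1.
Proof.
rewrite /dp -scalemxAr -[x *m _]exprS scalerA factS natrM invfM mulrA mulfV ?mul1r//.
by rewrite pnatr_eq0.
Qed.

Lemma dp_leibniz mu x k X Y : sder mu x ->
  dp x k *m smul mu X Y = \sum_(i < k.+1) smul mu (dp x i *m X) (dp x (k - i) *m Y).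
Proof.
move=> dx; elim: k => [|k IH].
  by rewrite big_ord1 /dp fact0 invr1 scale1r expr0 !mul1mx.
have k0 : k.+1%:R != 0 :> F by rewrite pnatr_eq0.
apply: (scalerI k0); rewrite scalemxAl -dpS -mulmxA IH mulmx_sumr.
pose s i := smul mu (dp x i *m X) (dp x (k.+1 - i) *m Y).
transitivity (\sum_(i < k.+1) (i.+1%:R *: s i.+1 + (k.+1 - i)%:R *: s i)).
  apply: eq_bigr => i _; have ik := ltn_ord i.
  have Eik : (k.+1 - i = (k - i).+1)%N by rewrite subSn// -ltnS.
  by rewrite dx !mulmxA !dpS -!(scalemxAl _.+1%:R) smulZl smulZr /s subSS Eik.
rewrite big_split /= scaler_sumr.
(* Both sums gain a null term, after which the coefficients i and k+1-i add up to k+1. *)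
transitivity (\sum_(i < k.+2) i%:R *: s i + \sum_(i < k.+2) (k.+1 - i)%:R *: s i).
  rewrite [X in _ = X + _]big_ord_recl scale0r add0r.
  by rewrite [X in _ = _ + X]big_ord_recr /= subnn scale0r addr0.
rewrite -big_split; apply: eq_bigr => i _ /=; rewrite -scalerDl -natrD.
by rewrite subnKC// -ltnS.
Qed.

Lemma expmx_saut mu x : sder mu x -> x ^+ n.+1 = 0 -> saut mu (expmx x).
Proof.
move=> dx x0; have dp0 i : (n < i)%N -> dp x i = 0.
  by move=> ni; rewrite /dp -(subnK ni) exprD x0 mulr0 scaler0.
split=> [|X Y].
  rewrite /expmx big_ord_recl {1}/dp fact0 invr1 scale1r expr0.
  pose w := \sum_(i < (2 * n).+1) (i.+1`!%:R : F)^-1 *: x ^+ i.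
  have -> : \sum_(i < (2 * n).+1) dp x (lift ord0 i) = x * w.
    by rewrite mulr_sumr; apply: eq_bigr => i _; rewrite /dp -scalerAr -exprS.
  apply: (@unitmx1D_nilpotent _ _ _ n.+1); rewrite exprMn_comm ?x0 ?mul0r//.
  apply: commr_sum => i _; rewrite /GRing.comm -scalerAr -scalerAl.
  by rewrite -exprS -exprSr.
rewrite /expmx; set M := (2 * n).+2.
transitivity (\sum_(i < M) \sum_(j < M) smul mu (dp x i *m X) (dp x j *m Y)).
  rewrite mulmx_suml.
  (* The triangle i <= k < M is reindexed by j = k - i, then completed to a square. *)
  transitivity (\sum_(0 <= k < M) \sum_(0 <= i < M | (i <= k)%N)
      smul mu (dp x i *m X) (dp x (k - i) *m Y)).
    rewrite big_mkord; apply: eq_bigr => k _; rewrite dp_leibniz//.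
    rewrite -(big_mkord xpredT (fun i => smul mu (dp x i *m X) (dp x (k - i) *m Y))).
    by rewrite (big_nat_widen 0 k.+1 M).
  rewrite (exchange_big_dep xpredT)//= big_mkord; apply: eq_bigr => i _.
  have iM := ltn_ord i.
  transitivity (\sum_(i <= j < M) smul mu (dp x i *m X) (dp x (j - i) *m Y)).
    by rewrite [RHS](big_nat_widenl _ 0).
  rewrite -[X in \sum_(X <= _ < _) _]add0n big_addn big_mkord.
  transitivity (\sum_(j < M - i) smul mu (dp x i *m X) (dp x j *m Y)).
    by apply: eq_bigr => j _; rewrite addnK.
  rewrite -[RHS](big_mkord xpredT (fun j => smul mu (dp x i *m X) (dp x j *m Y))).
  rewrite (@big_cat_nat _ _ _ (M - i)%N) ?leq_subr//= big_mkord.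
  (* The added terms have i + j >= 2n+2, so one exponent exceeds n. *)
  rewrite [X in _ + X]big_nat_cond [X in _ + X]big1 ?addr0// => j /andP[/andP[j1 j2] _].
  have [ni|ni] := ltnP n i; first by rewrite dp0// mul0mx smul0l.
  have nj : (n < j)%N by move: (nat_of_ord i) ni j1 => l; rewrite /M; lia.
  by rewrite (dp0 j nj) mul0mx smul0r.
rewrite mulmx_suml smul_suml; apply: eq_bigr => i _.
by rewrite mulmx_suml smul_sumr.
Qed.
End Exponential.

(** * Uniqueness up to automorphisms *)

Section Uniqueness.
Variables (C : numClosedFieldType) (n : nat).
Implicit Types (mu : stc C n.+1) (A phi psi x y P g : 'M[C]_n.+1)
  (d : 'rV[C]_n.+1) (X Y v : 'cV[C]_n.+1).

Lemma sautV mu g : saut mu g -> saut mu (invmx g).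
Proof.
move=> [gu gm]; split=> [|X Y]; first by rewrite unitmx_inv.
by rewrite -{1}[X](mulKVmx gu) -{1}[Y](mulKVmx gu) -gm mulKmx.
Qed.

Lemma sautM mu g h : saut mu g -> saut mu h -> saut mu (g *m h).
Proof.
move=> [gu gm] [hu hm]; split=> [|X Y]; first by rewrite unitmx_mul gu.
by rewrite -!mulmxA hm gm.
Qed.

Lemma saut1 mu : saut mu 1%:M.
Proof. by split=> [|X Y]; rewrite ?unitmx1 ?mul1mx. Qed.

Lemma sder_conj mu g A : saut mu g -> sder mu A -> sder mu (g *m A *m invmx g).
Proof.
move=> ag dA X Y; have [gu gm] := ag; have [_ gVm] := sautV ag.
by rewrite -!mulmxA gVm dA mulmxDr !gm !mulKVmx.
Qed.

Lemma snik_conj mu g phi : saut mu g -> snik mu phi -> snik mu (g *m phi *m invmx g).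
Proof.
move=> ag [dphi [P [d [Pu dR Ephi]]] tr_phi]; have [gu _] := ag; split.
- exact: sder_conj.
- exists (g *m P), d; split=> //; first by rewrite unitmx_mul gu.
  by rewrite Ephi invmxM ?unitmx_mul// !mulmxA.
move=> psi dpsi; rewrite -!mulmxA mxtrace_mulC -!mulmxA.
have /tr_phi := sder_conj (sautV ag) dpsi; rewrite invmxK -!mulmxA => ->.
by rewrite mxtrace_mulC -mulmxA mulmxV// mulmx1.
Qed.

Definition rad mu psi := sder mu psi /\
  forall chi, sder mu chi -> \tr (psi *m chi) = 0.

Lemma rad_lin mu : lin_closed (rad mu).
Proof.
split.
- by split=> [|chi _]; [exact: sder0|rewrite mul0mx mxtrace0].
- move=> A B [dA tA] [dB tB]; split=> [|chi dchi]; first exact: sderD.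
  by rewrite mulmxDl mxtraceD tA ?tB ?addr0.
- move=> a A [dA tA]; split=> [|chi dchi]; first exact: sderZ.
  by rewrite -scalemxAl mxtraceZ tA// mulr0.
Qed.

(** Invariance of the trace form: tr([A,x] chi) = tr(x [chi,A]). *)
Lemma rad_bracket mu A x : sder mu A -> rad mu x -> rad mu (A *m x - x *m A).
Proof.
move=> dA [dx tx]; split=> [|chi dchi]; first exact: sder_bracket.
rewrite mulmxBl raddfB /= -mulmxA mxtrace_mulC -!mulmxA -raddfB /= -mulmxBr.
by apply: tx; exact: sder_bracket.
Qed.

Lemma rad_conj mu g x : saut mu g -> rad mu x -> rad mu (g *m x *m invmx g).
Proof.
move=> ag [dx tx]; have [gu _] := ag; split=> [|chi dchi]; first exact: sder_conj.
rewrite -!mulmxA mxtrace_mulC -!mulmxA; apply: tx.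
by have := sder_conj (sautV ag) dchi; rewrite invmxK -!mulmxA.
Qed.

Lemma rad_snikB mu phi1 phi2 : snik mu phi1 -> snik mu phi2 -> rad mu (phi2 - phi1).
Proof.
move=> [d1 _ t1] [d2 _ t2]; split=> [|chi dchi]; first exact: sderB.
by rewrite mulmxBl raddfB /= t1// t2// subrr.
Qed.

(* Test [x] against the derivation obtained by conjugating the eigenvalues of
   its semisimple part. *)
Lemma rad_nilpotent mu x : rad mu x -> x ^+ n.+1 = 0.
Proof.
move=> [dx tx]; have [p [Sdiag N0]] := jordan_chevalley x.
have : comm_mx (horner_mx x p) x by exact: comm_horner_mx.
have [N EN] : exists N, N = x - horner_mx x p by exists (x - horner_mx x p).
rewrite -EN in N0.
have {EN} : x = horner_mx x p + N by rewrite EN addrC subrK.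
move: (horner_mx x p) Sdiag => s Sdiag Ex comm_s.
have [P [d [Pu Es]]] := diagonalizable_decomp Sdiag.
have comm_sN : s *m N = N *m s.
  by move: comm_s; rewrite /comm_mx Ex mulmxDl mulmxDr => /addrI.
have Nk k : (n.+1 <= k)%N -> N ^+ k = 0.
  by move=> nk; rewrite -(subnK nk) exprD N0 mulr0.
pose e : 'rV[C]_n.+1 := map_mx Num.conj d.
have Sd : compat (supp (transp P mu)) d.
  move=> i j k; rewrite inE; apply: (sder_jordan Pu _ Nk); rewrite -Es//.
  by rewrite -Ex.
have de : sder mu (P *m diag_mx e *m invmx P).
  (* Complex conjugation is additive, so it preserves the relations d_k = d_i + d_j. *)
  apply/(sder_diagP mu e Pu) => i j k ijk.
  by rewrite !mxE (Sd i j k ijk) rmorphD.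
(* The conjugated derivation is a polynomial in s, hence commutes with [N]; only the sum of the
   |d_k|^2 survives in the trace. *)
have [q Hq] := poly_crt [seq d 0 i | i : 'I_n.+1] Num.conj 1.
have Ee : P *m diag_mx e *m invmx P = horner_mx s q.
  rewrite Es horner_mx_uconj// horner_mx_diag; congr (_ *m diag_mx _ *m _).
  apply/rowP => k; rewrite !mxE.
  have := Hq (d 0 k) (map_f _ (mem_enum predT k)).
  by rewrite expr1 dvdp_XsubCl rootE !hornerE subr_eq0 => /eqP.
have tNe : \tr (N *m (P *m diag_mx e *m invmx P)) = 0.
  apply: (@mxtrace_nilpotent _ _ _ n.+1); rewrite exprMn_comm ?N0 ?mul0r//.
  by rewrite Ee /GRing.comm -!mulmxE; apply/esym/comm_horner_mx.
have := tx _ de; rewrite Ex mulmxDl mxtraceD tNe addr0 Es tr_conj_diag//.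
move=> /eqP; rewrite psumr_eq0 => [/allP H|k _]; last first.
  by rewrite mxE mulrC -normCK exprn_ge0.
have -> : d = 0.
  apply/rowP => k; have := H k (mem_index_enum k).
  by rewrite !mxE mulrC -normCK expf_eq0 normr_eq0 => /andP[_ /eqP].
by rewrite linear0 mulmx0 mul0mx add0r.
Qed.

(** * The filtration of matrices induced by the radical *)

Section Filter.
Variable mu : stc C n.+1.

(* Matrices lowering the filtration [kfil (rad mu)] by at least [k] steps. *)
Definition flt k x := forall j v, kfil (rad mu) (j + k) v -> kfil (rad mu) j (x *m v).

Lemma flt0 k : flt k 0.
Proof. by move=> j v _; rewrite mul0mx; exact: kfil0. Qed.

Lemma fltD k x y : flt k x -> flt k y -> flt k (x + y).
Proof. by move=> Fx Fy j v Kv; rewrite mulmxDl; apply: kfilD; [exact: Fx|exact: Fy]. Qed.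

Lemma fltZ k a x : flt k x -> flt k (a *: x).
Proof. by move=> Fx j v Kv; rewrite -scalemxAl; apply: kfilZ; exact: Fx. Qed.

Lemma fltN k x : flt k x -> flt k (- x).
Proof. by move=> Fx; rewrite -scaleN1r; exact: fltZ. Qed.

Lemma fltB k x y : flt k x -> flt k y -> flt k (x - y).
Proof. by move=> Fx Fy; apply: fltD => //; exact: fltN. Qed.

Lemma flt_mul k l x y : flt k x -> flt l y -> flt (k + l) (x *m y).
Proof. by move=> Fx Fy j v Kv; rewrite -mulmxA; apply: Fx; apply: Fy; rewrite -addnA. Qed.

Lemma flt_le k l x : (k <= l)%N -> flt l x -> flt k x.
Proof. by move=> kl Fx j v Kv; apply: Fx; apply: kfil_le Kv; rewrite leq_add2l. Qed.

Lemma flt_mul_le m k l x y : flt k x -> flt l y -> (m <= k + l)%N -> flt m (x *m y).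
Proof. by move=> Fx Fy /flt_le; apply; exact: flt_mul. Qed.

Lemma flt_rad x : rad mu x -> flt 1 x.
Proof. by move=> rx j v; rewrite addn1; apply. Qed.

Lemma flt_sder A : sder mu A -> flt 0 A.
Proof. by move=> dA j v; rewrite addn0; apply: kfil_stable => x; exact: rad_bracket. Qed.

Lemma flt_saut g : saut mu g -> flt 0 g.
Proof.
move=> ag j v; rewrite addn0; elim: j v => [|j IH] v /=; first by move=> ->; rewrite mulmx0.
move=> Kv x rx; have [gu _] := ag.
have -> : x *m (g *m v) = g *m (invmx g *m x *m g *m v) by rewrite !mulmxA mulmxV// mul1mx.
apply: IH; apply: Kv.
by have := rad_conj (sautV ag) rx; rewrite invmxK.
Qed.

Lemma flt_horner A p : flt 0 A -> flt 0 (horner_mx A p).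
Proof.
move=> FA; elim/poly_ind: p => [|p c IH]; first by rewrite rmorph0; exact: flt0.
rewrite rmorphD rmorphM /= horner_mx_X horner_mx_C; apply: fltD.
  exact: (flt_mul IH FA).
move=> j v; rewrite addn0 mul_scalar_mx; exact: kfilZ.
Qed.

Lemma flt_exp k x i : flt k x -> flt (k * i) (x ^+ i).
Proof.
move=> Fx; elim: i => [|i IH].
  by rewrite muln0 expr0 => j v; rewrite addn0 mul1mx.
by rewrite mulnS exprS; exact: flt_mul.
Qed.

(** First-order Taylor formula, by Horner's scheme: terms quadratic in nu have order 2(k+1) >= k+2,
    and e is negligible without commuting with anything. *)
Lemma flt_taylor k phi nu e p : flt 0 phi -> flt k.+1 nu -> flt k.+2 e ->
  phi *m nu = nu *m phi ->
  flt k.+2 (horner_mx (phi + nu + e) p - horner_mx phi p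
            - nu *m horner_mx phi (deriv p)).
Proof.
move=> Fphi Fnu Fe comm; set A := phi + nu + e.
have FA : flt 0 A.
  exact: fltD (fltD Fphi (flt_le (leq0n _) Fnu)) (flt_le (leq0n _) Fe).
elim/poly_ind: p => [|p c IH].
  by rewrite deriv0 !rmorph0 mulmx0 !subr0; exact: flt0.
rewrite derivMXaddC !rmorphD !rmorphM /= !horner_mx_X !horner_mx_C.
set H := horner_mx phi p in IH *; set H' := horner_mx phi _ in IH *.
set HA := horner_mx A p in IH *.
have Hnu : H *m nu = nu *m H by apply: comm_horner_mx.
have -> : HA * A + c%:M - (H * phi + c%:M) - nu *m (H + H' * phi) =
    (HA - H - nu *m H') *m A + (H *m e + nu *m H' *m (nu + e)).
  rewrite -!mulmxE /A !(mulmxDr, mulmxDl, mulNmx) Hnu !mulmxA.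
  by apply/matrixP => i j; rewrite !mxE; ring.
have FH q : flt 0 (horner_mx phi q) by exact: flt_horner.
apply: fltD; first by apply: flt_mul_le IH FA _; rewrite addn0.
apply: fltD; first by apply: flt_mul_le (FH p) Fe _.
have Fne : flt k.+1 (nu + e) by apply: fltD => //; apply: flt_le Fe.
by apply: flt_mul_le (flt_mul Fnu (FH _)) Fne _; lia.
Qed.

Lemma flt_expmx k x : flt k x -> exists2 y, expmx x = 1 + x + y & flt (k + k) y.
Proof.
move=> Fx; exists (\sum_(i < 2 * n) (i.+2`!%:R : C)^-1 *: x ^+ i.+2).
  rewrite /expmx !big_ord_recl /= -addrA !fact0 factS fact0 muln1 !invr1 !scale1r.
  by rewrite expr0 expr1.
apply: big_ind => [||i _]; [exact: flt0|exact: fltD|].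
apply: fltZ; rewrite -addn2 exprD -mulmxE.
apply: flt_mul_le (@flt_exp _ _ i Fx) (@flt_exp _ _ 2 Fx) _; lia.
Qed.

(* If the squarefree polynomial [m] annihilates both matrices, then Taylor's
   formula gives nu * m'(phi) = 0 modulo [flt k.+2], and m'(phi) is invertible. *)
Lemma flt_semisimple k phi nu e : flt 0 phi -> flt k.+1 nu -> flt k.+2 e ->
  phi *m nu = nu *m phi -> diagonalizable phi -> diagonalizable (phi + nu + e) ->
  flt k.+2 nu.
Proof.
move=> Fphi Fnu Fe comm /diagonalizable_decomp[P [a [Pu Ea]]].
move=> /diagonalizable_decomp[Q [b [Qu Eb]]].
pose rs := undup ([seq a 0 i | i : 'I_n.+1] ++ [seq b 0 i | i : 'I_n.+1]).
pose m := \prod_(r <- rs) ('X - r%:P).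
have m0 (W : 'M[C]_n.+1) (c : 'rV[C]_n.+1) : W \in unitmx ->
    (forall i, c 0 i \in rs) -> horner_mx (W *m diag_mx c *m invmx W) m = 0.
  move=> Wu crs; rewrite horner_mx_uconj// horner_mx_diag.
  have -> : map_mx (horner m) c = 0.
    apply/rowP => i; rewrite !mxE; apply/eqP.
    by rewrite -rootE root_prod_XsubC crs.
  by rewrite linear0 mulmx0 mul0mx.
have mphi : horner_mx phi m = 0.
  by rewrite Ea m0// => i; rewrite mem_undup mem_cat image_f.
have mh : horner_mx (phi + nu + e) m = 0.
  by rewrite Eb m0// => i; rewrite mem_undup mem_cat image_f ?orbT.
have := flt_taylor m Fphi Fnu Fe comm; rewrite mh mphi subrr sub0r => /fltN; rewrite opprK => Fm.
have : separable_poly m by rewrite separable_prod_XsubC undup_uniq.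
rewrite separable_poly.unlock => /Bezout_eq1_coprimepP[[u w] /= uw].
have -> : nu = nu *m horner_mx phi m^`() *m horner_mx phi w.
  have := congr1 (horner_mx phi) uw; rewrite rmorphD !rmorphM rmorph1 /=.
  rewrite mphi mulr0 add0r comm_horner_mx2 => Ew.
  by rewrite -mulmxA mulmxE Ew mulr1.
by apply: flt_mul_le Fm (flt_horner w Fphi) _; rewrite addn0.
Qed.

Lemma snik_diagonalizable phi : snik mu phi -> diagonalizable phi.
Proof.
case=> _ [P [d [Pu _ ->]]] _; exists (invmx P); first by rewrite unitmx_inv.
apply/diagonalizable_forLR; rewrite ?unitmx_inv//.
by exists d; rewrite invmxK mxpoly.conjumx.
Qed.

(* Split phi2 - phi1 = nu + [x, phi1] with [nu] commuting with [phi1]: conjugation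
   by exp(x) absorbs the bracket, and [nu] vanishes by semisimplicity. *)
Lemma snik_step k phi1 phi2 : snik mu phi1 -> snik mu phi2 ->
  flt k.+1 (phi2 - phi1) ->
  exists2 g, saut mu g & flt k.+2 (phi2 - g *m phi1 *m invmx g).
Proof.
move=> nik1 nik2 F12; have [d1 [P [d [Pu _ E1]]] _] := nik1.
have [d2 _ _] := nik2; have [r0 rD rZ] := rad_lin mu.
pose U A := rad mu A /\ flt k.+1 A.
have U_lin : lin_closed U.
  split; first by split; [exact: r0|exact: flt0].
    by move=> A B [rA FA] [rB FB]; split; [exact: rD|exact: fltD].
  by move=> a A [rA FA]; split; [exact: rZ|exact: fltZ].
have U_ad A : U A -> U (P *m diag_mx d *m invmx P *m A - A *m (P *m diag_mx d *m invmx P)).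
  rewrite -E1 => -[rA FA]; split; first exact: rad_bracket.
  have F1 := flt_sder d1.
  by apply: fltB; [exact: flt_mul_le F1 FA _|apply: flt_mul_le FA F1 _; rewrite addn0].
have U12 : U (phi2 - phi1) by split => //; exact: rad_snikB.
have [nu [x [[_ Fnu] [rx Fx] E12 comm]]] := ad_split Pu U_lin U_ad U12.
rewrite -E1 in comm E12.
have ag : saut mu (expmx x) by apply: expmx_saut (rad_nilpotent rx); case: rx.
have [y Eg Fy] := flt_expmx Fx.
exists (expmx x) => //; move: (expmx x) Eg ag => g Eg ag.
have [gu _] := ag; have agV := sautV ag.
pose e := invmx g *m phi2 *m g - phi1 - nu.
have Fe : flt k.+2 e.
  have -> : e = invmx g *m (g *m e) by rewrite mulKmx.
  apply: (flt_mul_le (flt_saut agV) _ (leqnn _)).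
  (* With g = 1 + x + y, the first-order terms cancel against nu + [x, phi1]; every remaining
     product has order at least k+2. *)
  have -> : g *m e = (phi2 - phi1) *m x + phi2 *m y - y *m phi1 - x *m nu - y *m nu.
    have -> : g *m e = phi2 *m g - g *m phi1 - g *m nu.
      by rewrite /e !mulmxBr !mulmxA mulmxV// mul1mx.
    have E2 : phi2 = phi1 + nu + (x *m phi1 - phi1 *m x).
      by rewrite -addrA -E12 addrC subrK.
    rewrite Eg [in LHS]mulmxDr [in LHS]mulmxDr mulmx1 {1}E2.
    rewrite !(mulmxDl, mulNmx) !mul1mx.
    by apply/matrixP => i j; rewrite !mxE; ring.
  have [F1 F2] := (flt_sder d1, flt_sder d2).
  apply: fltB; last by apply: flt_mul_le Fy Fnu _; lia.
  apply: fltB; last by apply: flt_mul_le Fx Fnu _; lia.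
  apply: fltB; last by apply: flt_mul_le Fy F1 _; lia.
  by apply: fltD; [apply: flt_mul_le F12 Fx _|apply: flt_mul_le F2 Fy _]; lia.
have Eh : phi1 + nu + e = invmx g *m phi2 *m g.
  by rewrite /e -[_ - phi1 - nu]addrA -opprD [LHS]addrC subrK.
have nikh : snik mu (phi1 + nu + e).
  by have := snik_conj agV nik2; rewrite invmxK Eh.
have {}Fnu : flt k.+2 nu.
  apply: flt_semisimple Fnu Fe comm _ _; [exact: flt_sder|exact: snik_diagonalizable|].
  exact: snik_diagonalizable.
have -> : phi2 - g *m phi1 *m invmx g = g *m (nu + e) *m invmx g.
  have -> : nu + e = invmx g *m phi2 *m g - phi1 by rewrite -Eh -[phi1 + nu + e]addrA [X in X - _]addrC addrK.
  rewrite mulmxBr mulmxBl; congr (_ - _).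
  by rewrite !mulmxA mulmxV// mul1mx mulmxK.
have Fne := fltD Fnu Fe.
have Fg := flt_mul_le (flt_saut ag) Fne (leqnn _).
by apply: flt_mul_le Fg (flt_saut agV) _; rewrite addn0.
Qed.

(** The difference starts in order 1, being in the radical; each [snik_step] gains one order, and by
    Engel a matrix of high enough order is zero. *)
Theorem snik_unique phi1 phi2 : snik mu phi1 -> snik mu phi2 ->
  exists2 g, saut mu g & phi2 = g *m phi1 *m invmx g.
Proof.
move=> nik1 nik2.
have [m Km] : exists m, forall v, kfil (rad mu) m v.
  apply: (engel (rad_lin mu)) => [x y [dx _]|x]; [exact: rad_bracket|exact: rad_nilpotent].
have [g ag Fg] : exists2 g, saut mu g & flt m.+1 (phi2 - g *m phi1 *m invmx g).
  elim: m {Km} => [|k [g ag Fg]].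
    exists 1%:M; first exact: saut1.
    by rewrite invmx1 mulmx1 mul1mx; apply/flt_rad/rad_snikB.
  have [h ah Fh] := snik_step (snik_conj ag nik1) nik2 Fg.
  exists (h *m g); first exact: sautM.
  by have [[hu _] [gu _]] := (ah, ag); rewrite invmxM// !mulmxA in Fh *.
exists g => //; apply/eqP; rewrite -subr_eq0; apply/eqP.
move: (phi2 - _) Fg => z Fz.
apply/matrixP => i j; have : z *m delta_mx j (0 : 'I_1) = 0.
  by apply: (Fz 0%N); apply: kfil_le (Km _); exact: leqnSn.
by rewrite -colE => /colP/(_ i); rewrite !mxE.
Qed.
End Filter.
End Uniqueness.

(** * Critical points *)

Section Moment.
Variables (C : numClosedFieldType) (n : nat).
Implicit Types (mu : stc C n.+1) (A D M : 'M[C]_n.+1).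

Definition adjmx A : 'M[C]_n.+1 := (map_mx Num.conj A)^T.

Definition lmul mu i : 'M[C]_n.+1 := \matrix_(k, j) mu i j k 0.
Definition rmul mu i : 'M[C]_n.+1 := \matrix_(k, j) mu j i k 0.

Definition moment mu : 'M[C]_n.+1 :=
  2%:R *: (\sum_(i < n.+1) lmul mu i *m adjmx (lmul mu i))
  - 2%:R *: (\sum_(i < n.+1) adjmx (lmul mu i) *m lmul mu i)
  - 2%:R *: (\sum_(i < n.+1) adjmx (rmul mu i) *m rmul mu i).

Lemma adjmxK A : adjmx (adjmx A) = A.
Proof. by apply/matrixP => i j; rewrite !mxE conjCK. Qed.

Lemma adjmxM A B : adjmx (A *m B) = adjmx B *m adjmx A.
Proof. by rewrite /adjmx map_mxM trmx_mul. Qed.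

Lemma adjmxD A B : adjmx (A + B) = adjmx A + adjmx B.
Proof. by rewrite /adjmx map_mxD linearD. Qed.

Lemma adjmxN A : adjmx (- A) = - adjmx A.
Proof. by rewrite /adjmx map_mxN linearN. Qed.

Lemma adjmxZ a A : adjmx (a *: A) = a^* *: adjmx A.
Proof. by rewrite /adjmx map_mxZ linearZ. Qed.

Lemma adjmx_sum I (r : seq I) (B : I -> 'M[C]_n.+1) :
  adjmx (\sum_(i <- r) B i) = \sum_(i <- r) adjmx (B i).
Proof.
apply: (big_morph adjmx adjmxD); apply/matrixP => i j.
by rewrite !mxE rmorph0.
Qed.

Lemma moment_adj mu : adjmx (moment mu) = moment mu.
Proof.
rewrite /moment !(adjmxD, adjmxN, adjmxZ, adjmx_sum) conjC_nat.
by congr (_ *: _ - _ *: _ - _ *: _); apply: eq_bigr => i _; rewrite adjmxM adjmxK.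
Qed.

Lemma tr_adjmx A B : \tr (adjmx A *m B) = \sum_j \sum_k (A k j)^* * B k j.
Proof.
by rewrite /mxtrace; apply: eq_bigr => j _; rewrite mxE; apply: eq_bigr => k _; rewrite !mxE.
Qed.

(** This makes [moment] the moment map of the GL_n-action, up to scale: its three sums match the
    three terms of [tact]. *)
Lemma tr_moment mu A :
  \tr (moment mu *m A) = 2%:R * \sum_i \sum_j \sum_k (mu i j k 0)^* * tact A mu i j k 0.
Proof.
rewrite /moment !mulmxBl !raddfB /= -!scalemxAl !mxtraceZ -!mulrBr; congr (_ * _).
have tr_sum (B : 'I_n.+1 -> 'M[C]_n.+1) : \tr (\sum_i B i) = \sum_i \tr (B i).
  exact: raddf_sum.
rewrite !mulmx_suml !tr_sum.
have E1 : \sum_i \tr (lmul mu i *m adjmx (lmul mu i) *m A) =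
    \sum_i \sum_j \sum_k (mu i j k 0)^* * (A *m mu i j) k 0.
  apply: eq_bigr => i _; rewrite -mulmxA mxtrace_mulC -mulmxA tr_adjmx.
  apply: eq_bigr => j _; apply: eq_bigr => k _; rewrite !mxE; congr (_ * _).
  by apply: eq_bigr => l _; rewrite mxE.
have E2 : \sum_i \tr (adjmx (lmul mu i) *m lmul mu i *m A) =
    \sum_i \sum_j \sum_k (mu i j k 0)^* *
      smul mu (delta_mx i 0) (A *m delta_mx j 0) k 0.
  apply: eq_bigr => i _; rewrite -mulmxA tr_adjmx.
  apply: eq_bigr => j _; apply: eq_bigr => k _; rewrite !mxE; congr (_ * _).
  rewrite (col_sum_delta (A *m _)) smul_sumr summxE; apply: eq_bigr => l _.
  by rewrite smulZr smul_delta -colE !mxE mulrC.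
have E3 : \sum_i \tr (adjmx (rmul mu i) *m rmul mu i *m A) =
    \sum_i \sum_j \sum_k (mu i j k 0)^* *
      smul mu (A *m delta_mx i 0) (delta_mx j 0) k 0.
  rewrite [RHS]exchange_big; apply: eq_bigr => i _; rewrite -mulmxA tr_adjmx.
  apply: eq_bigr => j _; apply: eq_bigr => k _; rewrite !mxE; congr (_ * _).
  rewrite (col_sum_delta (A *m _)) smul_suml summxE; apply: eq_bigr => l _.
  by rewrite smulZl smul_delta -colE !mxE mulrC.
rewrite E1 E2 E3 -!sumrB; apply: eq_bigr => i _; rewrite -!sumrB.
apply: eq_bigr => j _; rewrite -!sumrB; apply: eq_bigr => k _.
by rewrite /tact !mxE; ring.
Qed.

Lemma tr_moment_sder mu A : sder mu A -> \tr (moment mu *m A) = 0.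
Proof.
move=> dA; rewrite tr_moment big1 ?mulr0// => i _; rewrite big1// => j _.
rewrite big1// => k _; rewrite /tact -[mu i j]smul_delta dA.
by rewrite -addrA -opprD subrr mxE mulr0.
Qed.

Lemma tr_sqr_adj_eq0 M : adjmx M = M -> \tr (M *m M) = 0 -> M = 0.
Proof.
move=> EM; rewrite -{1}EM tr_adjmx => /eqP.
have ge0 (a : C) : 0 <= a^* * a by rewrite mulrC -normCK exprn_ge0.
rewrite psumr_eq0 => [/allP H|j _]; last by rewrite sumr_ge0.
apply/matrixP => i j; have := H j (mem_index_enum j).
rewrite psumr_eq0 // => /allP/(_ i (mem_index_enum i)).
by rewrite mulrC -normCK expf_eq0 normr_eq0 mxE => /andP[_ /eqP].
Qed.

(** The identity matrix acts by [tact] as -1, so the trace of the moment matrix is -2 times the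
    squared norm of [mu]. *)
Lemma tr_moment_neq0 mu : \tr (moment mu) = 0 -> mu = fun _ _ => 0.
Proof.
rewrite -[moment mu]mulmx1 tr_moment => /eqP; rewrite mulf_eq0 pnatr_eq0 /=.
have -> : \sum_i \sum_j \sum_k (mu i j k 0)^* * tact 1%:M mu i j k 0 =
    - \sum_i \sum_j \sum_k `|mu i j k 0| ^+ 2.
  rewrite -sumrN; apply: eq_bigr => i _; rewrite -sumrN; apply: eq_bigr => j _.
  rewrite -sumrN; apply: eq_bigr => k _; rewrite /tact !mul1mx smul_delta normCK !mxE.
  by ring.
have sq_ge0 (a : C) : 0 <= `|a| ^+ 2 by rewrite exprn_ge0.
rewrite oppr_eq0 psumr_eq0 => [/allP H|i _]; last first.
  by apply: sumr_ge0 => j _; exact: sumr_ge0.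
apply/funext => i; apply/funext => j; apply/colP => k; rewrite mxE.
have := H i (mem_index_enum i).
rewrite psumr_eq0 => [/allP/(_ j (mem_index_enum j))|l _]; last exact: sumr_ge0.
rewrite psumr_eq0 // => /allP/(_ k (mem_index_enum k)).
by rewrite expf_eq0 normr_eq0 => /andP[_ /eqP].
Qed.

Lemma moment_snik mu c D : c \is Num.real -> mu <> (fun _ _ => 0) ->
  sder mu D -> moment mu = c%:M + D -> snik mu (- c^-1 *: D).
Proof.
move=> cR mu0 dD EM.
have tr_psi psi : sder mu psi -> c * \tr psi + \tr (D *m psi) = 0.
  move=> /tr_moment_sder; rewrite EM mulmxDl mxtraceD.
  by rewrite mul_scalar_mx mxtraceZ.
(* If c = 0, the moment matrix is itself a derivation, hence orthogonal to itself; being Hermitian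
   it vanishes, which forces mu = 0. *)
have c0 : c != 0.
  apply/eqP => c0; apply/mu0/tr_moment_neq0.
  rewrite [moment mu]tr_sqr_adj_eq0 ?mxtrace0 ?moment_adj//.
  by rewrite {2}EM c0 raddf0 add0r tr_moment_sder.
have adjD : adjmx D = D.
  have -> : D = moment mu - c%:M by rewrite EM addrC addKr.
  rewrite adjmxD adjmxN moment_adj; congr (_ - _).
  by apply/matrixP => i j; rewrite !mxE eq_sym rmorphMn /= (CrealP cR).
split; first exact: sderZ.
(* D is Hermitian as M - cI, so the spectral theorem diagonalises it with real eigenvalues. *)
- have Dherm : D \is hermsymmx.
    apply/is_hermitianmxP; rewrite expr0 scale1r -{1}adjD.
    by apply/matrixP => i j; rewrite !mxE.
  have /orthomx_spectralP ED := hermitian_normalmx Dherm.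
  have sp_real := hermitian_spectral_diag_real Dherm.
  have Pu := unitarymx_unit (spectral_unitarymx D).
  exists (invmx (spectralmx D)), (- c^-1 *: spectral_diag D); split.
  + by rewrite unitmx_inv.
  + move=> k; rewrite mxE realM// ?realN ?realV//.
    by have /mxOverP := sp_real; apply.
  + by rewrite invmxK {1}ED linearZ /= -scalemxAr -scalemxAl.
- move=> psi dpsi; rewrite -scalemxAl mxtraceZ.
  have /eqP := tr_psi _ dpsi; rewrite addrC addr_eq0 => /eqP->.
  by rewrite mulrNN mulKf.
Qed.
End Moment.

Theorem theorem4p1 (R : realType) (n : nat) (mu : alg R n) :
  (exists phi, is_nik mu phi) /\
  (forall phi1 phi2, is_nik mu phi1 -> is_nik mu phi2 ->
     exists g, is_aut mu g /\ phi2 = g *m phi1 *m invmx g) /\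
  (forall phi, is_nik mu phi ->
     forall a : R[i], eigenvalue phi a -> exists q : rat, a = ratr q) /\
  (forall (c : R) (D : 'M[R[i]]_n), crit_data mu c D ->
     is_nik mu (- ((c%:C)%C)^-1 *: D)).
Proof.
case: n mu => [|n] mu.
  (* Dimension 0 is treated apart: the lemmas above use the ring of matrices of size [n.+1]. *)
  have mx0 (A B : 'M[R[i]]_0) : A = B by apply/matrixP => -[].
  have cv0 (X Y : 'cV[R[i]]_0) : X = Y by apply/matrixP => -[].
  have nik0 phi : is_nik mu phi.
    split; [by move=> X Y; exact: cv0| |by move=> psi _; rewrite (mx0 (phi *m psi) psi)].
    by exists 1%:M, 0; split; [rewrite unitmx1|case|exact: mx0].
  split; [by exists 0|split; [|split]] => [phi1 phi2 _ _|phi _ a|c D _].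
  - by exists 1%:M; split; [split; [rewrite unitmx1|move=> X Y; exact: cv0]|exact: mx0].
  - by move=> /eigenvalueP[v _ /eqP]; case; apply/matrixP => ? -[].
  - exact: nik0.
split; [|split; [|split]].
- exact: (@snik_exists _ n mu).
- move=> phi1 phi2 nik1 nik2.
  by have [g ag ->] := @snik_unique _ n mu _ _ nik1 nik2; exists g.
- move=> phi [dphi [P [d [Pu dR Ephi]]] tr_phi] a /eigenvalueP[v va v0].
  rewrite Ephi in dphi tr_phi va.
  have [q Eq] := @snik_rational _ n mu P d Pu dR tr_phi dphi.
  (* In the eigenbasis, a nonzero coordinate k of the eigenvector forces a = d_k. *)
  have [k vk] : exists k, (v *m P) 0 k != 0.
    apply: contrapT => H; case/negP: v0; rewrite -(mulmxK Pu v).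
    suff -> : v *m P = 0 by rewrite mul0mx.
    apply/rowP => k; rewrite [RHS]mxE; apply/eqP; apply: contrapT => /negP vk.
    by apply: H; exists k.
  exists (q 0 k); move/(congr1 (mulmx^~ P)): va; rewrite !mulmxA mulmxKV// -scalemxAl.
  move/rowP/(_ k); rewrite mul_mx_diag mxE [RHS]mxE => Ea.
  suff -> : a = d 0 k by rewrite Eq mxE.
  by apply: (mulIf vk); rewrite -Ea mulrC.
- move=> c D [mu0 dD EM].
  apply: (@moment_snik _ n mu) => //.
  by apply/complex_realP; exists c.
Qed.
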